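(* Let $M^{2n+1}(\varphi,\xi,\eta,g)$ be a Kenmotsu manifold of dimension $2n+1$. Suppose that $g$ represents an $\eta$-Ricci soliton with non-zero potential vector field $V$, i.e. there are real constants $\lambda,\mu$ such that $$\tfrac12\,\mathcal{L}_V g+\mathrm{Ric}+\lambda\,g+\mu\,\eta\otimes\eta=0 ,$$ and that $V$ is collinear to $\xi$, i.e. $V=\sigma\,\xi$ for some smooth function $\sigma$ on $M$. Then $g$ is Einstein with constant scalar curvature $r=-2n(2n+1)$.
   Context: An almost contact structure on a smooth manifold $M^{2n+1}$ of dimension $2n+1$ is a triple $(\varphi,\xi,\eta)$, where $\varphi$ is a $(1,1)$-tensor, $\xi$ a vector field (the Reeb vector field) and $\eta$ a $1$-form with $\varphi^2=-I+\eta\otimes\xi$ and $\eta(\xi)=1$. A Riemannian metric $g$ is compatible if $g(\varphi X,\varphi Y)=g(X,Y)-\eta(X)\eta(Y)$ for all vector fields $X,Y$; then $M(\varphi,\xi,\eta,g)$ is an almost contact metric manifold. It is a Kenmotsu manifold if $(\nabla_X\varphi)Y=g(\varphi X,Y)\,\xi-\eta(Y)\,\varphi X$ for all vector fields $X,Y$, where $\nabla$ is the Levi-Civita connection of $g$. Here $\mathcal{L}_V$ is the Lie derivative along $V$, $\mathrm{Ric}$ the Ricci tensor, $r$ the scalar curvature of $g$, and $(\eta\otimes\eta)(X,Y)=\eta(X)\eta(Y)$. Einstein means that $\mathrm{Ric}$ is a constant multiple of $g$. *)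

(* Defs.v *)
From HB Require Import structures.
From mathcomp Require Import all_boot all_order all_algebra.
From mathcomp Require Import all_classical all_reals all_analysis.
Import Order.TTheory GRing.Theory Num.Theory.
Import numFieldNormedType.Exports.
Set Implicit Arguments.
Unset Strict Implicit.
Unset Printing Implicit Defensive.
Local Open Scope classical_set_scope.
Local Open Scope ring_scope.

Definition basis_vec {R : realType} {d : nat} (i : 'I_d) : 'rV[R]_d :=
  delta_mx 0 i.

(* k-fold differentiability on an open set A of R^d: f is (Frechet)
   differentiable on A and its partial derivatives are (k-1)-fold
   differentiable on A. *)
Fixpoint diff_upto {R : realType} {d : nat} (k : nat)
    (A : set 'rV[R]_d) (f : 'rV[R]_d -> R) : Prop :=
  match k with
  | 0 => True
  | k'.+1 => (forall x, A x -> differentiable f x) /\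
             (forall i : 'I_d, diff_upto k' A (fun x => 'D_(basis_vec i) f x))
  end.

Definition smooth_on {R : realType} {d : nat}
    (A : set 'rV[R]_d) (f : 'rV[R]_d -> R) : Prop :=
  forall k, diff_upto k A f.

(* A homeomorphism cmap from the open set cdom of T onto an open set of R^d,
   with inverse cinv. Both maps are total functions; their values outside
   cdom, resp. cmap @` cdom, are irrelevant. *)
Record chart (R : realType) (d : nat) (T : topologicalType) := Chart {
  cdom : set T ;
  cmap : T -> 'rV[R]_d ;
  cinv : 'rV[R]_d -> T ;
  cdom_open : open cdom ;
  cimg_open : open (cmap @` cdom) ;
  cmapK : forall p, cdom p -> cinv (cmap p) = p ;
  cmap_continuous : forall p, cdom p -> {for p, continuous cmap} ;
  cinv_continuous : forall p, cdom p -> {for cmap p, continuous cinv} }.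

(* A smooth structure is given by a smooth atlas, which need not be maximal.
   chart_at selects, at each point, a chart of the atlas around that point; it
   exists on every manifold, and serves only to name the elements of the
   tangent spaces (see tangent below). *)
Record smoothManifold (R : realType) (d : nat) := SmoothManifold {
  carrier :> topologicalType ;
  carrier_hausdorff : hausdorff_space carrier ;
  carrier_second_countable : @second_countable carrier ;
  atlas : set (chart R d carrier) ;
  chart_at : carrier -> chart R d carrier ;
  chart_at_atlas : forall p, atlas (chart_at p) ;
  chart_at_dom : forall p, cdom (chart_at p) p ;
  atlas_compat : forall c c', atlas c -> atlas c' -> forall i : 'I_d,
    smooth_on (cmap c @` (cdom c `&` cdom c'))
              (fun x => cmap c' (cinv c x) 0 i) }.

(* smoothness on the open set U of M *)
Definition smooth_fun {R : realType} {d : nat} (M : smoothManifold R d)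
    (U : set M) (f : M -> R) : Prop :=
  forall c, atlas c ->
    smooth_on (cmap c @` (U `&` cdom c)) (fun x => f (cinv c x)).

(* A tangent vector at p is represented by its components in the chart
   chart_at p. A vector given by its components a in another chart c
   around p is 'D_a (cmap (chart_at p) \o cinv c) (cmap c p). *)
Definition tangent {R : realType} {d : nat} (M : smoothManifold R d) (p : M) :=
  'rV[R]_d.

(* v f, the derivative at p of a function f along the tangent vector v *)
Definition tderiv {R : realType} {d : nat} (M : smoothManifold R d)
    {W : normedModType R} (p : M) (v : tangent p) (f : M -> W) : W :=
  'D_v (f \o cinv (chart_at p)) (cmap (chart_at p) p).

(* A vector field on an open set U is the restriction to U of such a function;
   the values outside U are irrelevant. *)
Definition vfield {R : realType} {d : nat} (M : smoothManifold R d) :=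
  forall p : M, tangent p.

(* The components of X in the chart c are the derivatives along X of the
   coordinate functions of c. *)
Definition smooth_vfield {R : realType} {d : nat} (M : smoothManifold R d)
    (U : set M) (X : vfield M) : Prop :=
  forall c, atlas c -> forall i : 'I_d,
    smooth_fun (U `&` cdom c) (fun q => tderiv (X q) (cmap c) 0 i).

(* [X, Y] has components X (Y x^i) - Y (X x^i), where the x^i are the
   coordinate functions. *)
Definition bracket {R : realType} {d : nat} (M : smoothManifold R d)
    (X Y : vfield M) : vfield M := fun p =>
  let x := cmap (chart_at p) in
  tderiv (X p) (fun q => tderiv (Y q) x) -
  tderiv (Y p) (fun q => tderiv (X q) x).

(* the coordinate vector field d/dx^i of the chart chart_at p *)
Definition coord_vfield {R : realType} {d : nat} (M : smoothManifold R d)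
    (p : M) (i : 'I_d) : vfield M := fun q =>
  'D_(basis_vec i) (cmap (chart_at q) \o cinv (chart_at p))
                   (cmap (chart_at p) q).

(* Tensor fields are given pointwise. Identities between them are tested on
   vector fields defined on arbitrary open subsets of M; since both sides are
   tensorial, this amounts to testing them on global vector fields. *)

Record riemannian_metric {R : realType} {d : nat} (M : smoothManifold R d)
    (g : forall p : M, tangent p -> tangent p -> R) : Prop := {
  metric_sym : forall p (u v : tangent p), g p u v = g p v u ;
  metric_linear : forall p (u : tangent p), scalar (g p u) ;
  metric_pos : forall p (v : tangent p), v != 0 -> 0 < g p v v ;
  metric_smooth : forall (U : set M) (X Y : vfield M), open U ->
    smooth_vfield U X -> smooth_vfield U Y ->
    smooth_fun U (fun p => g p (X p) (Y p)) }.

(* A connection acts on the vector fields of each open set U of M, compatibly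
   with restriction (conn_local). *)
Record affine_connection {R : realType} {d : nat} (M : smoothManifold R d)
    (nabla : vfield M -> vfield M -> vfield M) : Prop := {
  conn_local : forall (U : set M) (X X' Y Y' : vfield M), open U ->
    smooth_vfield U X -> smooth_vfield U X' ->
    smooth_vfield U Y -> smooth_vfield U Y' ->
    (forall p, U p -> X p = X' p) -> (forall p, U p -> Y p = Y' p) ->
    forall p, U p -> nabla X Y p = nabla X' Y' p ;
  conn_smooth : forall (U : set M) (X Y : vfield M), open U ->
    smooth_vfield U X -> smooth_vfield U Y -> smooth_vfield U (nabla X Y) ;
  conn_linear_l : forall (U : set M) (f : M -> R) (X X' Y : vfield M), open U ->
    smooth_fun U f -> smooth_vfield U X -> smooth_vfield U X' ->
    smooth_vfield U Y -> forall p, U p ->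
    nabla (fun q => f q *: X q + X' q) Y p = f p *: nabla X Y p + nabla X' Y p ;
  conn_add_r : forall (U : set M) (X Y Y' : vfield M), open U ->
    smooth_vfield U X -> smooth_vfield U Y -> smooth_vfield U Y' ->
    forall p, U p ->
    nabla X (fun q => Y q + Y' q) p = nabla X Y p + nabla X Y' p ;
  conn_leibniz : forall (U : set M) (f : M -> R) (X Y : vfield M), open U ->
    smooth_fun U f -> smooth_vfield U X -> smooth_vfield U Y ->
    forall p, U p ->
    nabla X (fun q => f q *: Y q) p =
      tderiv (X p) f *: Y p + f p *: nabla X Y p }.

Record levi_civita {R : realType} {d : nat} (M : smoothManifold R d)
    (g : forall p : M, tangent p -> tangent p -> R)
    (nabla : vfield M -> vfield M -> vfield M) : Prop := {
  lc_connection : affine_connection nabla ;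
  lc_torsion_free : forall (U : set M) (X Y : vfield M), open U ->
    smooth_vfield U X -> smooth_vfield U Y -> forall p, U p ->
    nabla X Y p - nabla Y X p = bracket X Y p ;
  lc_metric : forall (U : set M) (X Y Z : vfield M), open U ->
    smooth_vfield U X -> smooth_vfield U Y -> smooth_vfield U Z ->
    forall p, U p ->
    tderiv (X p) (fun q => g q (Y q) (Z q)) =
      g p (nabla X Y p) (Z p) + g p (Y p) (nabla X Z p) }.

Definition curvature {R : realType} {d : nat} (M : smoothManifold R d)
    (nabla : vfield M -> vfield M -> vfield M) (X Y Z : vfield M) : vfield M :=
  fun p => nabla X (nabla Y Z) p - nabla Y (nabla X Z) p
           - nabla (bracket X Y) Z p.

(* Ric(Y, Z) is the trace of X |-> curvature(X, Y) Z, computed at p in the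
   frame of coordinate vector fields of chart_at p, which are represented at p
   by the standard basis. *)
Definition ricci {R : realType} {d : nat} (M : smoothManifold R d)
    (nabla : vfield M -> vfield M -> vfield M) (Y Z : vfield M) (p : M) : R :=
  \sum_(i < d) (curvature nabla (coord_vfield p i) Y Z p) 0 i.

(* the metric trace g^{ij} Ric_{ij} *)
Definition scalar_curvature {R : realType} {d : nat} (M : smoothManifold R d)
    (g : forall p : M, tangent p -> tangent p -> R)
    (nabla : vfield M -> vfield M -> vfield M) (p : M) : R :=
  \tr (invmx (\matrix_(i < d, j < d) g p (basis_vec i) (basis_vec j)) *m
       \matrix_(i < d, j < d)
         ricci nabla (coord_vfield p i) (coord_vfield p j) p).

Definition einstein {R : realType} {d : nat} (M : smoothManifold R d)
    (g : forall p : M, tangent p -> tangent p -> R)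
    (nabla : vfield M -> vfield M -> vfield M) : Prop :=
  exists a : R, forall (U : set M) (X Y : vfield M), open U ->
    smooth_vfield U X -> smooth_vfield U Y -> forall p, U p ->
    ricci nabla X Y p = a * g p (X p) (Y p).

(* (L_V g)(X, Y) = V (g (X, Y)) - g ([V, X], Y) - g (X, [V, Y]) *)
Definition lie_metric {R : realType} {d : nat} (M : smoothManifold R d)
    (g : forall p : M, tangent p -> tangent p -> R) (V X Y : vfield M) (p : M) :
    R :=
  tderiv (V p) (fun q => g q (X q) (Y q))
  - g p (bracket V X p) (Y p) - g p (X p) (bracket V Y p).

Record almost_contact {R : realType} {n : nat}
    (M : smoothManifold R (2 * n + 1))
    (phi : forall p : M, tangent p -> tangent p) (xi : vfield M)
    (eta : forall p : M, tangent p -> R) : Prop := {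
  ac_phi_linear : forall p, linear (phi p) ;
  ac_phi_smooth : forall (U : set M) (X : vfield M), open U ->
    smooth_vfield U X -> smooth_vfield U (fun p => phi p (X p)) ;
  ac_xi_smooth : smooth_vfield setT xi ;
  ac_eta_linear : forall p, scalar (eta p) ;
  ac_eta_smooth : forall (U : set M) (X : vfield M), open U ->
    smooth_vfield U X -> smooth_fun U (fun p => eta p (X p)) ;
  ac_phi_sq : forall p (v : tangent p),
    phi p (phi p v) = - v + eta p v *: xi p ;
  ac_eta_xi : forall p, eta p (xi p) = 1 }.

Record almost_contact_metric {R : realType} {n : nat}
    (M : smoothManifold R (2 * n + 1))
    (phi : forall p : M, tangent p -> tangent p) (xi : vfield M)
    (eta : forall p : M, tangent p -> R)
    (g : forall p : M, tangent p -> tangent p -> R) : Prop := {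
  acm_contact : almost_contact phi xi eta ;
  acm_metric : riemannian_metric g ;
  acm_compatible : forall p (u v : tangent p),
    g p (phi p u) (phi p v) = g p u v - eta p u * eta p v }.

Record kenmotsu {R : realType} {n : nat} (M : smoothManifold R (2 * n + 1))
    (phi : forall p : M, tangent p -> tangent p) (xi : vfield M)
    (eta : forall p : M, tangent p -> R)
    (g : forall p : M, tangent p -> tangent p -> R)
    (nabla : vfield M -> vfield M -> vfield M) : Prop := {
  kenmotsu_acm : almost_contact_metric phi xi eta g ;
  kenmotsu_lc : levi_civita g nabla ;
  kenmotsu_eq : forall (U : set M) (X Y : vfield M), open U ->
    smooth_vfield U X -> smooth_vfield U Y -> forall p, U p ->
    nabla X (fun q => phi q (Y q)) p - phi p (nabla X Y p) =
      g p (phi p (X p)) (Y p) *: xi p - eta p (Y p) *: phi p (X p) }.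

Definition eta_ricci_soliton {R : realType} {d : nat} (M : smoothManifold R d)
    (eta : forall p : M, tangent p -> R)
    (g : forall p : M, tangent p -> tangent p -> R)
    (nabla : vfield M -> vfield M -> vfield M)
    (V : vfield M) (lambda mu : R) : Prop :=
  forall (U : set M) (X Y : vfield M), open U ->
    smooth_vfield U X -> smooth_vfield U Y -> forall p, U p ->
    2^-1 * lie_metric g V X Y p + ricci nabla X Y p
      + lambda * g p (X p) (Y p) + mu * (eta p (X p) * eta p (Y p)) = 0.

(* Main.v *)
Require Import Defs.
From HB Require Import structures.
From mathcomp Require Import all_boot all_order all_algebra.
From mathcomp Require Import all_classical all_reals all_analysis.
From mathcomp Require Import ring lra.
Import Order.TTheory GRing.Theory Num.Theory.
Import numFieldNormedType.Exports.
Local Open Scope classical_set_scope.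
Local Open Scope ring_scope.

Set Implicit Arguments.
Unset Strict Implicit.
Unset Printing Implicit Defensive.

(** The defining equation of a Kenmotsu manifold, applied to [xi], gives
    [nabla_X xi = X - eta(X) xi] ([nabla_xi]).  It follows that
    [R(X,Y) xi = eta(X) Y - eta(Y) X] and, by the first Bianchi identity and
    the skewness of [R], that [R(xi,Y) Z = eta(Z) Y - g(Y,Z) xi]; in
    particular [Ric(Y,xi) = - 2n eta(Y)] ([curv_xi], [curv_xil], [ric_xi]).

    Since [L_(sigma xi) g] is the sum of [dsigma (x) eta + eta (x) dsigma] and
    of [2 sigma h], where [h = g - eta (x) eta], the soliton equation on the
    pair [(X, xi)] forces [dsigma = c eta] for the constant
    [c = 2n - lambda - mu].  The soliton equation then reads
    [Ric = - (sigma + lambda) g + (sigma - c - mu) eta (x) eta]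
    ([soliton_xi], [soliton_ric]).

    What remains is to find [sigma], and this takes one more derivative: the
    second Bianchi identity with one argument equal to [xi], once traced, says
    that the covariant derivative of [Ric] along [xi] is [- 2 Ric - 4n g]
    ([radial_ric]).  With the above form of [Ric] it becomes [F h = 0], where
    [F = 4n - c - 2 (sigma + lambda)] ([soliton_radial]).
    At a point where [h(Y,Z)] is not zero, [F] vanishes,
    and so does [xi F = - 2 c], by differentiating [F h = 0] along [xi]; hence
    [c = 0], [sigma = 2n - lambda], and [Ric(Y,Z) = - 2n g(Y,Z)].  At a point
    where [h(Y,Z) = 0] the form of [Ric] gives the same value directly
    ([soliton_einstein]).  The scalar curvature is the trace.

    All this is local, and is done in an abstract calculus of functions and
    vector fields over a set [U] ([field_calculus]), whose instances are the
    open subsets of a chart domain ([chart_field_calculus]).  The analytic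
    content of the instance is the symmetry of second derivatives
    ([derive_symmetry]), which makes [[X,Y]] the commutator of the derivations
    [X] and [Y] ([tderiv_bracket]), and the stability of smoothness under
    changes of charts, which makes the coordinate fields smooth
    ([smooth_coord_vfield]).  The frame in which the Ricci tensor is traced
    varies from point to point; [ricci_trace] replaces it by a single frame,
    so that the trace can be differentiated. *)

(** * Differential calculus on open subsets of R^d *)

Lemma near_eq_differentiable (R : realType) (V W : normedModType R)
    (f g : V -> W) (x : V) :
  (\forall y \near x, f y = g y) -> differentiable f x -> differentiable g x.
Proof.
move=> fg df.
have nfg : \forall h \near (0 : V), f (h + x) = g (h + x).
  have := fg; rewrite (near_shift 0 x (fun y => f y = g y)).
  by apply: filterS => h /=; rewrite subr0.
have go : g \o shift x = cst (g x) + 'd f x +o_ 0 id.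
  apply/eqaddoP => e e0; have := df => /diff_locallyP [_ /eqaddoP /(_ e e0)].
  move=> fo; near=> h.
  rewrite /= !fctE /= -(near nfg h)// -(nbhs_singleton fg).
  exact: (near fo h).
have dfc := diff_continuous df; have dgf := diff_unique dfc go.
have dgc : continuous ('d g x) by rewrite dgf.
have go' : g \o shift x = cst (g x) + 'd g x +o_ 0 id by rewrite dgf.
exact: (diff_locallyP _ _).2 (conj dgc go').
Unshelve. all: by end_near. Qed.

Lemma differentiable_rV (R : realType) (V : normedModType R) (d : nat)
    (f : V -> 'rV[R]_d) (x : V) :
  (forall j, differentiable (fun y => f y 0 j) x) -> differentiable f x.
Proof.
move=> df.
rewrite (_ : f = \sum_(j < d) (fun y => f y 0 j *: basis_vec j)); last first.
  by apply/funext => y; rewrite fct_sumE {1}[f y]row_sum_delta.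
by apply: differentiable_sum => j; exact: differentiableZl.
Qed.

Lemma derive_basis (R : realType) (W : normedModType R) (d : nat)
    (f : 'rV[R]_d -> W) (x v : 'rV[R]_d) :
  differentiable f x ->
  'D_v f x = \sum_(i < d) v 0 i *: 'D_(basis_vec i) f x.
Proof.
move=> df; rewrite deriveE// {1}[v]row_sum_delta linear_sum.
by apply: eq_bigr => i _; rewrite linearZ deriveE.
Qed.

Lemma deriveDl (R : realType) (V W : normedModType R) (f : V -> W) (x u v : V)
    (k : R) :
  differentiable f x -> 'D_(k *: u + v) f x = k *: 'D_u f x + 'D_v f x.
Proof. by move=> df; rewrite !deriveE// linearP. Qed.

Lemma derive_comp (R : realType) (U V W : normedModType R) (t : U -> V)
    (f : V -> W) (x v : U) :
  differentiable t x -> differentiable f (t x) ->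
  'D_v (f \o t) x = 'D_('D_v t x) f (t x).
Proof.
move=> dt df; rewrite !deriveE//; last exact: differentiable_comp.
by rewrite diff_comp.
Qed.

Lemma derive_coord (R : realType) (V : normedModType R) (d : nat)
    (f : V -> 'rV[R]_d) (x v : V) (j : 'I_d) :
  differentiable f x -> ('D_v f x) 0 j = 'D_v (fun y => f y 0 j) x.
Proof. by move=> df; rewrite derive_mx ?mxE//; exact: diff_derivable. Qed.

Section Smooth.
Variables (R : realType) (d : nat).
Implicit Types (A B : set 'rV[R]_d) (f g : 'rV[R]_d -> R).

Lemma diff_upto_eq k A f g : open A -> (forall x, A x -> f x = g x) ->
  diff_upto k A f -> diff_upto k A g.
Proof.
move=> oA; elim: k f g => [//|k IH] f g fg [df Df].
have nfg x : A x -> \forall y \near x, f y = g y.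
  by move=> Ax; apply: filterS (open_nbhs_nbhs (conj oA Ax)).
split=> [x Ax|i]; first exact: near_eq_differentiable (nfg x Ax) (df x Ax).
by apply: IH (Df i) => x Ax; exact/near_eq_derive/nfg.
Qed.

Lemma diff_uptoS A B k f : A `<=` B -> diff_upto k B f -> diff_upto k A f.
Proof.
move=> AB; elim: k f => [//|k IH] f [df Df].
by split=> [x /AB /df|i]//; exact/IH/Df.
Qed.

Lemma diff_uptoW k A f : diff_upto k.+1 A f -> diff_upto k A f.
Proof.
elim: k f => [//|k IH] f [df Df]; split=> // i; exact/IH/Df.
Qed.

Lemma diff_upto_cst k A c : diff_upto k A (cst c).
Proof.
elim: k c => [//|k IH] c; split=> [x _|i]; first exact: differentiable_cst.
rewrite (_ : (fun _ => _) = cst 0); first exact: IH.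
by apply/funext => x; rewrite derive_cst.
Qed.

Lemma diff_uptoD k A f g : open A ->
  diff_upto k A f -> diff_upto k A g -> diff_upto k A (fun x => f x + g x).
Proof.
move=> oA; elim: k f g => [//|k IH] f g [df Df] [dg Dg].
split=> [x Ax|i]; first by apply: differentiableD; [exact: df|exact: dg].
apply: (@diff_upto_eq _ _ _ _ oA _ (IH _ _ (Df i) (Dg i))) => x Ax.
by rewrite [RHS]deriveD//; apply: diff_derivable; [exact: df|exact: dg].
Qed.

Lemma diff_uptoM k A f g : open A ->
  diff_upto k A f -> diff_upto k A g -> diff_upto k A (fun x => f x * g x).
Proof.
move=> oA; elim: k f g => [//|k IH] f g df dg.
have [df1 Df] := df; have [dg1 Dg] := dg.
split=> [x Ax|i]; first by apply: differentiableM; [exact: df1|exact: dg1].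
apply: (@diff_upto_eq _ _ (fun x => f x * 'D_(basis_vec i) g x +
                                    g x * 'D_(basis_vec i) f x)) => //.
  move=> x Ax.
  by rewrite [RHS]deriveM//; apply: diff_derivable; [exact: df1|exact: dg1].
apply: diff_uptoD => //; apply: IH => //.
- exact: (diff_uptoW df).
- exact: (Dg i).
- exact: (diff_uptoW dg).
- exact: (Df i).
Qed.

Lemma diff_upto_sum k A (F : 'I_d -> 'rV[R]_d -> R) : open A ->
  (forall j, diff_upto k A (F j)) -> diff_upto k A (fun x => \sum_j F j x).
Proof.
move=> oA dF.
suff H (s : seq 'I_d) : diff_upto k A (fun x => \sum_(j <- s) F j x).
  exact: H.
elim: s => [|j s IH].
  apply: (diff_upto_eq oA _ (diff_upto_cst k A 0)) => x _.
  by rewrite big_nil.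
apply: diff_upto_eq (diff_uptoD oA (dF j) IH) => // x _.
by rewrite big_cons.
Qed.

(** By induction on [k], through
    [D_i (f o t) = \sum_j (D_i t_j) ((D_j f) o t)]. *)
Lemma diff_upto_comp k A B f (t : 'rV[R]_d -> 'rV[R]_d) : open A ->
  (forall x, A x -> B (t x)) -> diff_upto k B f ->
  (forall j, diff_upto k A (fun x => t x 0 j)) ->
  diff_upto k A (f \o t).
Proof.
move=> oA tAB; elim: k f => [//|k IH] f [df Df] dt.
have dtx x : A x -> differentiable t x.
  by move=> Ax; apply: differentiable_rV => j; have [+ _] := dt j; exact.
split=> [x Ax|i].
  by apply: differentiable_comp; [exact: dtx|exact/df/tAB].
apply: (@diff_upto_eq _ _ (fun x => \sum_j 'D_(basis_vec i) (fun y => t y 0 j) x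
    * 'D_(basis_vec j) f (t x))) => //.
  move=> x Ax; rewrite derive_comp; [|exact: dtx|exact/df/tAB].
  rewrite derive_basis; last exact/df/tAB.
  by apply: eq_bigr => j _; rewrite derive_coord//; exact: dtx.
apply: diff_upto_sum => // j; apply: diff_uptoM => //.
  by have [_ /(_ i)] := dt j.
exact: (IH _ (Df j) (fun m => diff_uptoW (dt m))).
Qed.

End Smooth.

Lemma dist_lt_halves (R : realType) (a b c e : R) :
  `|a - c| < e / 2 -> `|b - c| < e / 2 -> `|a - b| <= e.
Proof.
move=> ac bc; rewrite -(subrKA c) (le_trans (ler_normD _ _))//.
by rewrite (distrC c) [leRHS]splitr ltW// ltrD.
Qed.

Section Schwarz.
Variables (R : realType) (V : normedModType R).
Implicit Types (f : V -> R) (x y u v : V).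

Lemma is_derive_line f y u (s : R) : differentiable f (s *: u + y) ->
  is_derive s 1 (fun s => f (s *: u + y)) ('D_u f (s *: u + y)).
Proof.
move=> df; pose t (s : R) := s *: u + y.
have dt : is_diff s t ( *:%R^~ u).
  rewrite (_ : t = (fun s => s *: u) + cst y); last by [].
  apply: is_diff_eq; exact: addr0.
have [dts dtE] := dt.
have dft : differentiable (f \o t) s by apply: differentiable_comp.
apply: DeriveDef; first exact: diff_derivable.
rewrite [LHS](@derive_comp _ _ _ _ t f)//.
by rewrite [in LHS](deriveE _ dts) dtE scale1r.
Qed.

(** The mean value theorem, first along [u] for the difference of [f] between
    two parallel segments, then along [v] for [D_u f].  The left-hand side is
    symmetric in [u] and [v], whereas the right-hand side is not. *)
Lemma second_difference f x u v (h : R) : 0 < h ->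
  (forall s t : R, 0 <= s <= h -> 0 <= t <= h ->
    differentiable f (x + s *: u + t *: v) /\
    differentiable ('D_u f) (x + s *: u + t *: v)) ->
  exists s t : R, [/\ 0 <= s <= h, 0 <= t <= h &
    f (x + h *: u + h *: v) - f (x + h *: u) - f (x + h *: v) + f x =
    h * h * 'D_v ('D_u f) (x + s *: u + t *: v)].
Proof.
move=> h0 df.
have h00 : 0 <= h <= h by rewrite (ltW h0) lexx.
have h01 : (0 : R) <= 0 <= h by rewrite lexx ltW.
pose F s := f (x + s *: u + h *: v) - f (x + s *: u).
have dF s : 0 <= s <= h ->
    is_derive s 1 F ('D_u f (x + s *: u + h *: v) - 'D_u f (x + s *: u)).
  move=> sh; pose F1 s := f (s *: u + (x + h *: v)).
  pose F2 s := f (s *: u + x).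
  rewrite (_ : F = F1 - F2); last first.
    by apply/funext => z; rewrite /F /F1 /F2 !fctE addrA (addrC x).
  have [d1 _] := df s h sh h00; have [d2 _] := df s 0 sh h01.
  rewrite scale0r addr0 addrC in d2; rewrite (addrC x) -addrA in d1.
  rewrite (addrC x) -addrA.
  by apply: is_deriveB; exact: is_derive_line.
have [|s||s sh] := @MVT_segment R F (fun s => 'D_u f (x + s *: u + h *: v) -
    'D_u f (x + s *: u)) 0 h; first exact: ltW.
- by rewrite in_itv/= => /andP[s0 sh]; apply: dF; rewrite !ltW.
- apply: derivable_within_continuous => s; rewrite in_itv/= => sh.
  by have [] := dF s sh.
rewrite in_itv/= in sh; rewrite subr0 {1 2}/F scale0r addr0 => FE.
pose G t := 'D_u f (x + s *: u + t *: v).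
have dG t : 0 <= t <= h ->
    is_derive t 1 G ('D_v ('D_u f) (x + s *: u + t *: v)).
  move=> th; have [_ d1] := df s t sh th.
  rewrite (_ : G = fun t => 'D_u f (t *: v + (x + s *: u))); last first.
    by apply/funext => z; rewrite /G addrC.
  rewrite (addrC _ (t *: v)) in d1; rewrite (addrC _ (t *: v)).
  exact: is_derive_line.
have [|t||t th] := @MVT_segment R G
  (fun t => 'D_v ('D_u f) (x + s *: u + t *: v)) 0 h; first exact: ltW.
- by rewrite in_itv/= => /andP[t0 th]; apply: dG; rewrite !ltW.
- apply: derivable_within_continuous => t; rewrite in_itv/= => th.
  by have [] := dG t th.
rewrite in_itv/= in th; rewrite subr0 {1 2}/G scale0r addr0 => GE.
exists s, t; split => //.
rewrite -mulrA (mulrC h ('D_v _ _)) -GE mulrC -FE; ring.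
Qed.

Lemma small_square x u v (r : R) : 0 < r -> exists2 h : R, 0 < h &
  forall s t : R, 0 <= s <= h -> 0 <= t <= h ->
    ball x r (x + s *: u + t *: v).
Proof.
move=> r0; pose m := `|u| + `|v| + 1.
have m0 : 0 < m by rewrite /m; have := normr_ge0 u; have := normr_ge0 v; lra.
exists (r / 2 / m); first by rewrite !divr_gt0.
set h := r / 2 / m => s t /andP[s0 sh] /andP[t0 th].
rewrite -ball_normE /= -addrA opprD addNKr normrN.
apply: le_lt_trans (ler_normD _ _) _; rewrite !normrZ !ger0_norm//.
have : s * `|u| + t * `|v| <= h * m.
  rewrite /m !mulrDr mulr1 -[leLHS]addr0 !lerD ?ler_wpM2r//.
  by rewrite !divr_ge0// ltW.
move/le_lt_trans; apply; rewrite /h divfK ?gt_eqF//.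
by rewrite ltr_pdivrMr// ltr_pMr// ltr1n.
Qed.

(** The second difference of [f] on a small square is [h * h] times a value of
    either mixed derivative near [x]; both are continuous at [x]. *)
Lemma derive_symmetry f x u v :
  (\forall y \near x, [/\ differentiable f y, differentiable ('D_u f) y &
     differentiable ('D_v f) y]) ->
  differentiable ('D_v ('D_u f)) x -> differentiable ('D_u ('D_v f)) x ->
  'D_v ('D_u f) x = 'D_u ('D_v f) x.
Proof.
move=> df /differentiable_continuous + /differentiable_continuous.
move=> /cvgrPdist_lt cvu /cvgrPdist_lt cuv.
apply/eqP; rewrite -subr_eq0 -normr_le0; apply/ler_addgt0Pr => e e0.
rewrite add0r.
have e2 : 0 < e / 2 by rewrite divr_gt0.
have {}cvu := cvu _ e2; have {}cuv := cuv _ e2.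
pose P1 := [set y | `|'D_v ('D_u f) x - 'D_v ('D_u f) y| < e / 2].
pose P2 := [set y | `|'D_u ('D_v f) x - 'D_u ('D_v f) y| < e / 2].
pose P0 := [set y | [/\ differentiable f y, differentiable ('D_u f) y &
   differentiable ('D_v f) y]].
have n1 : nbhs x P1 by exact: cvu.
have n2 : nbhs x P2 by exact: cuv.
have n0 : nbhs x P0 by exact: df.
have : nbhs x (P0 `&` (P1 `&` P2)) by exact: (filterI n0 (filterI n1 n2)).
move=> /nbhs_ballP [r /= r0 xr].
have [h h0 hr] := small_square x u v r0.
have [s t sh th|s [t [sh th E1]]] := @second_difference f x u v h h0.
  by have [[]] := xr _ (hr s t sh th).
have hr' (s' t' : R) : 0 <= s' <= h -> 0 <= t' <= h ->
    ball x r (x + s' *: v + t' *: u).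
  by move=> ? ?; rewrite addrAC; exact: hr.
have [s' t' sh' th'|s' [t' [sh' th' E2]]] := @second_difference f x v u h h0.
  by have [[]] := xr _ (hr' s' t' sh' th').
have [_ [A1 _]] := xr _ (hr s t sh th).
have [_ [_ A2]] := xr _ (hr' s' t' sh' th').
have E : 'D_v ('D_u f) (x + s *: u + t *: v) =
         'D_u ('D_v f) (x + s' *: v + t' *: u).
  apply: (@mulfI _ (h * h)); first by rewrite mulf_neq0// gt_eqF.
  apply: etrans (esym E1) (etrans _ E2).
  have -> : f (x + h *: v + h *: u) = f (x + h *: u + h *: v).
    by congr f; exact: addrAC.
  by congr (_ + _); exact: addrAC.
rewrite /P2/= -E in A2; exact: dist_lt_halves A1 A2.
Qed.

End Schwarz.

Lemma smooth_derive_symmetry (R : realType) (d : nat) (A : set 'rV[R]_d)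
    (f : 'rV[R]_d -> R) (x : 'rV[R]_d) (i j : 'I_d) :
  open A -> smooth_on A f -> A x ->
  'D_(basis_vec i) ('D_(basis_vec j) f) x =
  'D_(basis_vec j) ('D_(basis_vec i) f) x.
Proof.
move=> oA sf Ax; apply: derive_symmetry.
- near=> y; have Ay : A y by near: y; exact: (open_nbhs_nbhs (conj oA Ax)).
  have [df /= Df] := sf 2%N.
  by split; [exact: df|exact: (Df j).1|exact: (Df i).1].
- have [_ /(_ j) [_ /(_ i) [+ _]]] := sf 3%N; exact.
- have [_ /(_ i) [_ /(_ j) [+ _]]] := sf 3%N; exact.
Unshelve. all: by end_near. Qed.

(** * Charts and derivatives along tangent vectors *)

Section Charts.
Variables (R : realType) (d : nat) (M : smoothManifold R d).
Implicit Types (U : set M) (c : chart R d M) (p q : M) (f g : M -> R).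

Lemma chart_img_open c U : open U -> open (cmap c @` (U `&` cdom c)).
Proof.
move=> oU; rewrite openE => _ [p [Up cp] <-].
have n1 : nbhs (cmap c p) (cmap c @` cdom c).
  by apply: open_nbhs_nbhs; split; [exact: cimg_open|exists p].
have n2 : nbhs (cmap c p) (cinv c @^-1` U).
  apply: (cinv_continuous cp); rewrite (cmapK cp).
  exact: open_nbhs_nbhs (conj oU Up).
apply: filterS (filterI n1 n2) => _ [[q cq <-]].
by rewrite /= (cmapK cq) => Uq; exists q.
Qed.

Lemma chart_imgP c U y : (cmap c @` (U `&` cdom c)) y ->
  [/\ U (cinv c y), cdom c (cinv c y) & cmap c (cinv c y) = y].
Proof. by case=> p [Up cp] <-; rewrite (cmapK cp). Qed.

Lemma near_chart c U p : open U -> U p -> cdom c p ->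
  \forall y \near cmap c p,
    [/\ U (cinv c y), cdom c (cinv c y) & cmap c (cinv c y) = y].
Proof.
move=> oU Up cp; have oI : open (cmap c @` (U `&` cdom c)) by exact: chart_img_open.
have Ip : (cmap c @` (U `&` cdom c)) (cmap c p) by exists p.
by apply: filterS (open_nbhs_nbhs (conj oI Ip)) => y; exact: chart_imgP.
Qed.

Lemma transition_differentiable c c' p :
  atlas c -> atlas c' -> cdom c p -> cdom c' p ->
  differentiable (cmap c' \o cinv c) (cmap c p).
Proof.
move=> ac ac' cp cp'; apply: differentiable_rV => j.
by have [+ _] := atlas_compat ac ac' j 1%N; apply; exists p.
Qed.

Lemma near_change_chart (T : Type) c c' p (f : M -> T) :
  cdom c p -> cdom c' p ->
  \forall y \near cmap c p,
    (f \o cinv c) y = ((f \o cinv c') \o (cmap c' \o cinv c)) y.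
Proof.
move=> cp cp'; apply: filterS (near_chart (cdom_open c') cp' cp) => y [cy _ _].
by rewrite /= (cmapK cy).
Qed.

Lemma differentiable_change_chart (W : normedModType R) c c' p (f : M -> W) :
  atlas c -> atlas c' -> cdom c p -> cdom c' p ->
  differentiable (f \o cinv c') (cmap c' p) ->
  differentiable (f \o cinv c) (cmap c p).
Proof.
move=> ac ac' cp cp' df.
have h : differentiable ((f \o cinv c') \o (cmap c' \o cinv c)) (cmap c p).
  apply: differentiable_comp; first exact: transition_differentiable.
  by rewrite /= (cmapK cp).
apply: near_eq_differentiable h.
by apply: filterS (near_change_chart f cp cp') => y; exact: esym.
Qed.

Lemma derive_change_chart (W : normedModType R) c c' p (f : M -> W)
    (v : 'rV[R]_d) :
  atlas c -> atlas c' -> cdom c p -> cdom c' p ->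
  differentiable (f \o cinv c') (cmap c' p) ->
  'D_v (f \o cinv c) (cmap c p) =
  'D_('D_v (cmap c' \o cinv c) (cmap c p)) (f \o cinv c') (cmap c' p).
Proof.
move=> ac ac' cp cp' df; rewrite (near_eq_derive _ (near_change_chart f cp cp')).
rewrite derive_comp ?/= ?(cmapK cp)//; exact: transition_differentiable.
Qed.

Definition differentiable_at (W : normedModType R) (f : M -> W) p :=
  differentiable (f \o cinv (chart_at p)) (cmap (chart_at p) p).

Lemma differentiable_atP (W : normedModType R) c p (f : M -> W) :
  atlas c -> cdom c p ->
  differentiable (f \o cinv c) (cmap c p) <-> differentiable_at f p.
Proof.
move=> ac cp; have ap := chart_at_atlas p; have pp := chart_at_dom p.
by split; apply: differentiable_change_chart.
Qed.

(** A tangent vector is differentiated in the reference chart of its base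
    point; this computes the same derivative in any other chart. *)
Lemma tderivE (W : normedModType R) c p (v : tangent p) (f : M -> W) :
  atlas c -> cdom c p -> differentiable_at f p ->
  tderiv v f = 'D_(tderiv v (cmap c)) (f \o cinv c) (cmap c p).
Proof.
move=> ac cp df; apply: derive_change_chart => //.
- exact: chart_at_atlas.
- exact: chart_at_dom.
- exact/differentiable_atP.
Qed.

Lemma tderiv_chart_at p (v : tangent p) : tderiv v (cmap (chart_at p)) = v.
Proof.
have pp := chart_at_dom p; rewrite /tderiv.
rewrite -[RHS](derive_id (cmap (chart_at p) p)); apply: near_eq_derive.
by apply: filterS (near_chart (cdom_open _) pp pp) => y [].
Qed.

Lemma tderiv_eq (W : normedModType R) U p (v : tangent p) (f g : M -> W) :
  open U -> U p -> (forall q, U q -> f q = g q) -> tderiv v f = tderiv v g.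
Proof.
move=> oU Up fg; apply: near_eq_derive.
apply: filterS (near_chart oU Up (chart_at_dom p)) => y [Uy _ _]; exact: fg.
Qed.

Lemma cmap_differentiable_at c p : atlas c -> cdom c p ->
  differentiable_at (cmap c) p.
Proof.
move=> ac cp; apply: transition_differentiable => //.
- exact: chart_at_atlas.
- exact: chart_at_dom.
Qed.

Lemma tderiv_linear (W : normedModType R) p (f : M -> W) (k : R)
    (u v : tangent p) :
  differentiable_at f p ->
  tderiv (k *: u + v : tangent p) f = k *: tderiv u f + tderiv v f.
Proof. by move=> df; rewrite /tderiv deriveDl. Qed.

Lemma tderivD p (v : tangent p) f g :
  differentiable_at f p -> differentiable_at g p ->
  tderiv v (fun q => f q + g q) = tderiv v f + tderiv v g.
Proof. by move=> df dg; rewrite /tderiv -deriveD//; exact: diff_derivable. Qed.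

Lemma tderivM p (v : tangent p) f g :
  differentiable_at f p -> differentiable_at g p ->
  tderiv v (fun q => f q * g q) = f p * tderiv v g + g p * tderiv v f.
Proof.
move=> df dg; have cp := chart_at_dom p.
rewrite /tderiv [LHS](@deriveM _ _ (f \o cinv (chart_at p))
  (g \o cinv (chart_at p))); [|exact: diff_derivable..].
by rewrite /= (cmapK cp).
Qed.

Lemma tderiv_cst p (v : tangent p) (k : R) : tderiv v (fun=> k) = 0.
Proof. exact: derive_cst. Qed.

Lemma tderiv_coord p (v : tangent p) (F : M -> 'rV[R]_d) (j : 'I_d) :
  differentiable_at F p -> (tderiv v F) 0 j = tderiv v (fun q => F q 0 j).
Proof. by move=> dF; rewrite /tderiv derive_coord. Qed.

Lemma differentiable_at_rV p (F : M -> 'rV[R]_d) :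
  (forall j, differentiable_at (fun q => F q 0 j) p) -> differentiable_at F p.
Proof. exact: differentiable_rV. Qed.

End Charts.

(** * Smooth functions, smooth vector fields and their brackets *)

Lemma addr_cancel (V : zmodType) (s s' t t' : V) :
  t = t' -> (s + t) - (s' + t') = s - s'.
Proof. by move=> ->; rewrite opprD addrACA subrr addr0. Qed.

Lemma sum_symmetric_form (R : realType) (d : nat) (a b : 'I_d -> R)
    (D : 'I_d -> 'I_d -> R) : (forall i j, D i j = D j i) ->
  \sum_i \sum_j a i * b j * D i j = \sum_i \sum_j b i * a j * D i j.
Proof.
move=> Dsym; rewrite exchange_big; apply: eq_bigr => i _.
by apply: eq_bigr => j _; rewrite Dsym (mulrC (a j)).
Qed.

Section SmoothFields.
Variables (R : realType) (d : nat) (M : smoothManifold R d).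
Implicit Types (U : set M) (c : chart R d M) (p q : M) (f g : M -> R).
Implicit Types (X Y Z : vfield M).

Lemma smooth_fun_eq U f g : open U -> (forall q, U q -> f q = g q) ->
  smooth_fun U f -> smooth_fun U g.
Proof.
move=> oU fg sf c ac k; apply: diff_upto_eq (sf c ac k).
  exact: chart_img_open.
by move=> y /chart_imgP[Uy _ _]; exact: fg.
Qed.

Lemma smooth_fun_sub U U' f : U `<=` U' -> smooth_fun U' f -> smooth_fun U f.
Proof.
move=> UU' sf c ac k; apply: diff_uptoS (sf c ac k).
by move=> _ [q [Uq cq] <-]; exists q => //; split => //; exact: UU'.
Qed.

Lemma smooth_fun_cst U (k : R) : smooth_fun U (fun=> k).
Proof. by move=> c ac m; exact: diff_upto_cst. Qed.

Lemma smooth_funD U f g : open U -> smooth_fun U f -> smooth_fun U g ->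
  smooth_fun U (fun q => f q + g q).
Proof.
move=> oU sf sg c ac k; apply: diff_uptoD (sf c ac k) (sg c ac k).
exact: chart_img_open.
Qed.

Lemma smooth_funM U f g : open U -> smooth_fun U f -> smooth_fun U g ->
  smooth_fun U (fun q => f q * g q).
Proof.
move=> oU sf sg c ac k; apply: diff_uptoM (sf c ac k) (sg c ac k).
exact: chart_img_open.
Qed.

Lemma smooth_funN U f : open U -> smooth_fun U f -> smooth_fun U (fun q => - f q).
Proof.
move=> oU sf; apply: smooth_fun_eq (smooth_funM oU (smooth_fun_cst U (-1)) sf) => //.
by move=> q _; rewrite mulN1r.
Qed.

Lemma smooth_differentiable_at U f p : open U -> smooth_fun U f -> U p ->
  differentiable_at f p.
Proof.
move=> oU sf Up; have [+ _] := sf _ (chart_at_atlas p) 1%N; apply.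
by exists p => //; split => //; exact: chart_at_dom.
Qed.

Lemma smooth_fun_chart c i : atlas c -> smooth_fun (cdom c) (fun q => cmap c q 0 i).
Proof. by move=> ac c' ac'; rewrite setIC; exact: atlas_compat. Qed.

Definition component c X i q := tderiv (X q) (cmap c) 0 i.

Lemma tderiv_component c X f q : atlas c -> cdom c q -> differentiable_at f q ->
  tderiv (X q) f =
  \sum_i component c X i q * 'D_(basis_vec i) (f \o cinv c) (cmap c q).
Proof.
move=> ac cq df; rewrite (tderivE _ ac cq df) derive_basis//.
exact/differentiable_atP.
Qed.

(** In each chart [c] the function is the sum of the products of the components
    of [X] in [c] and of the partial derivatives in [c], so that no change of
    charts enters. *)
Lemma smooth_tderiv U X f : open U -> smooth_vfield U X -> smooth_fun U f ->
  smooth_fun U (fun q => tderiv (X q) f).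
Proof.
move=> oU sX sf c ac k; have oI : open (cmap c @` (U `&` cdom c)).
  exact: chart_img_open.
apply: (@diff_upto_eq _ _ _ _ (fun y => \sum_i component c X i (cinv c y) *
    'D_(basis_vec i) (f \o cinv c) y)) => //.
  move=> y /chart_imgP[Uy cy yE].
  have df := smooth_differentiable_at oU sf Uy.
  by rewrite (tderiv_component _ ac cy df) yE.
apply: diff_upto_sum => // i; apply: diff_uptoM => //.
  apply: diff_uptoS (sX c ac i c ac k).
  by move=> _ [q [Uq cq] <-]; exists q.
by have [_ /(_ i)] := sf c ac k.+1.
Qed.

Lemma smooth_vfield_eq U X Y : open U -> (forall q, U q -> X q = Y q) ->
  smooth_vfield U X -> smooth_vfield U Y.
Proof.
move=> oU XY sX c ac i; apply: smooth_fun_eq (sX c ac i).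
  by apply: openI => //; exact: cdom_open.
by move=> q [Uq _]; rewrite XY.
Qed.

Lemma smooth_vfield_sub U U' X : U `<=` U' -> smooth_vfield U' X ->
  smooth_vfield U X.
Proof.
move=> UU' sX c ac i; apply: smooth_fun_sub (sX c ac i).
by move=> q [/UU'].
Qed.

Lemma smooth_vfieldDZ U f X Y : open U -> smooth_fun U f ->
  smooth_vfield U X -> smooth_vfield U Y ->
  smooth_vfield U (fun q => f q *: X q + Y q).
Proof.
move=> oU sf sX sY c ac i.
have oI : open (U `&` cdom c) by apply: openI => //; exact: cdom_open.
apply: (@smooth_fun_eq _ (fun q => f q * component c X i q + component c Y i q)).
- exact: oI.
- move=> q [Uq cq]; rewrite tderiv_linear ?mxE//.
  exact: cmap_differentiable_at.
- apply: smooth_funD => //; last exact: sY.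
  apply: smooth_funM => //; last exact: sX.
  by apply: smooth_fun_sub sf => q [].
Qed.

Lemma smooth_vfield0 U : smooth_vfield U (fun q => 0 : tangent q).
Proof.
move=> c ac i; have oI : open (@setT M `&` cdom c).
  by apply: openI; [exact: openT|exact: cdom_open].
apply: (@smooth_fun_sub _ (setT `&` cdom c)) => [q []//|].
apply: (@smooth_fun_eq _ (fun=> 0)); [exact: oI| |exact: smooth_fun_cst].
by move=> q [_ cq]; rewrite /tderiv derive0 mxE.
Qed.

Lemma smooth_vfieldZ U f X : open U -> smooth_fun U f -> smooth_vfield U X ->
  smooth_vfield U (fun q => f q *: X q).
Proof.
move=> oU sf sX.
apply: smooth_vfield_eq (smooth_vfieldDZ oU sf sX (smooth_vfield0 U)) => // q _.
by rewrite addr0.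
Qed.

Lemma smooth_vfieldD U X Y : open U -> smooth_vfield U X -> smooth_vfield U Y ->
  smooth_vfield U (fun q => X q + Y q).
Proof.
move=> oU sX sY.
apply: smooth_vfield_eq (smooth_vfieldDZ oU (smooth_fun_cst U 1) sX sY) => // q _.
by rewrite scale1r.
Qed.

Lemma tderiv_chart_fun c q (v : tangent q) i : atlas c -> cdom c q ->
  tderiv v (cmap c) 0 i = tderiv v (fun q => cmap c q 0 i).
Proof. by move=> ac cq; rewrite tderiv_coord//; exact: cmap_differentiable_at. Qed.

Lemma bracket_component U X Y p i : open U ->
  smooth_vfield U X -> smooth_vfield U Y -> U p ->
  bracket X Y p 0 i = tderiv (X p) (component (chart_at p) Y i) -
                      tderiv (Y p) (component (chart_at p) X i).
Proof.
move=> oU sX sY Up; have ap := chart_at_atlas p; have pp := chart_at_dom p.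
have oW : open (U `&` cdom (chart_at p)).
  by apply: openI => //; exact: cdom_open.
have dZ Z : smooth_vfield U Z ->
    differentiable_at (fun q => tderiv (Z q) (cmap (chart_at p))) p.
  move=> sZ; apply: differentiable_at_rV => j.
  exact: (smooth_differentiable_at oW (sZ _ ap j)).
rewrite [LHS]mxE [X in _ + X]mxE.
by congr (_ - _); apply: tderiv_coord; exact: dZ.
Qed.

(** The part of [X (Y f)] of second order in [f], which is to be cancelled in
    the commutator by the symmetry of second derivatives, is kept apart. *)
Lemma tderiv_tderiv U X Y f p : open U -> smooth_vfield U X ->
  smooth_vfield U Y -> smooth_fun U f -> U p ->
  tderiv (X p) (fun q => tderiv (Y q) f) =
  \sum_i tderiv (X p) (component (chart_at p) Y i) *
         'D_(basis_vec i) (f \o cinv (chart_at p)) (cmap (chart_at p) p) +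
  \sum_i \sum_j Y p 0 i * X p 0 j *
         'D_(basis_vec j) ('D_(basis_vec i) (f \o cinv (chart_at p)))
            (cmap (chart_at p) p).
Proof.
move=> oU sX sY sf Up; set c := chart_at p.
have ap : atlas c := chart_at_atlas p; have pp : cdom c p := chart_at_dom p.
have oW : open (U `&` cdom c) by apply: openI => //; exact: cdom_open.
have Wp : (U `&` cdom c) p by [].
have dYi i : differentiable (component c Y i \o cinv c) (cmap c p).
  exact: (smooth_differentiable_at oW (sY _ ap i) Wp).
have oI : open (cmap c @` (U `&` cdom c)) by exact: chart_img_open.
have Ip : (cmap c @` (U `&` cdom c)) (cmap c p) by exists p.
have dfi i : differentiable ('D_(basis_vec i) (f \o cinv c)) (cmap c p).
  by have [_ /(_ i) [+ _]] := sf c ap 2%N; exact.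
rewrite [LHS](@near_eq_derive _ _ _ _ (\sum_i (component c Y i \o cinv c) *
    'D_(basis_vec i) (f \o cinv c))); last first.
  apply: filterS (open_nbhs_nbhs (conj oI Ip)) => y /chart_imgP[Uy cy yE].
  have df := smooth_differentiable_at oU sf Uy.
  rewrite /= (tderiv_component _ ap cy df) yE fct_sumE; exact: eq_bigr.
rewrite derive_sum; last first.
  move=> i; apply: derivableM; exact: diff_derivable.
rewrite -big_split/=; apply: eq_bigr => i _.
rewrite deriveM; [|exact: diff_derivable..].
rewrite [LHS]addrC; congr (_ + _); first exact: mulrC.
rewrite /= (cmapK pp) {1}/component tderiv_chart_at.
rewrite derive_basis// scaler_sumr; apply: eq_bigr => j _.
exact: mulrA.
Qed.

Lemma tderiv_bracket U X Y f p : open U -> smooth_vfield U X ->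
  smooth_vfield U Y -> smooth_fun U f -> U p ->
  tderiv (bracket X Y p) f =
  tderiv (X p) (fun q => tderiv (Y q) f) - tderiv (Y p) (fun q => tderiv (X q) f).
Proof.
move=> oU sX sY sf Up.
rewrite (tderiv_tderiv oU sX sY sf Up) (tderiv_tderiv oU sY sX sf Up).
set c := chart_at p; set x := cmap c p.
have ap : atlas c := chart_at_atlas p; have pp : cdom c p := chart_at_dom p.
have df : differentiable (f \o cinv c) x := smooth_differentiable_at oU sf Up.
pose D i j := 'D_(basis_vec j) ('D_(basis_vec i) (f \o cinv c)) x.
have oI : open (cmap c @` (U `&` cdom c)) by exact: chart_img_open.
have Dsym i j : D i j = D j i.
  by apply: (smooth_derive_symmetry _ _ oI (sf c ap)); exists p.
have sym := sum_symmetric_form (fun i => Y p 0 i) (fun j => X p 0 j) Dsym.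
apply: etrans (esym (addr_cancel _ _ sym)).
rewrite -sumrB [LHS](derive_basis _ df); apply: eq_bigr => i _.
by rewrite (bracket_component _ oU sX sY Up) -mulrBl.
Qed.

(** The components of the bracket in [c] are its derivatives of the coordinate
    functions of [c], to which [tderiv_bracket] applies. *)
Lemma smooth_bracket U X Y : open U -> smooth_vfield U X -> smooth_vfield U Y ->
  smooth_vfield U (bracket X Y).
Proof.
move=> oU sX sY c ac i.
have oW : open (U `&` cdom c) by apply: openI => //; exact: cdom_open.
have sX' : smooth_vfield (U `&` cdom c) X by apply: smooth_vfield_sub sX => q [].
have sY' : smooth_vfield (U `&` cdom c) Y by apply: smooth_vfield_sub sY => q [].
have sx : smooth_fun (U `&` cdom c) (fun q => cmap c q 0 i).
  by apply: smooth_fun_sub (smooth_fun_chart i ac) => q [].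
apply: (@smooth_fun_eq _ (fun q =>
    tderiv (X q) (fun q => tderiv (Y q) (fun q => cmap c q 0 i)) +
    - tderiv (Y q) (fun q => tderiv (X q) (fun q => cmap c q 0 i)))).
- exact: oW.
- move=> q Wq; rewrite -(tderiv_bracket oW sX' sY' sx Wq).
  by rewrite tderiv_chart_fun//; case: Wq.
- apply: smooth_funD => //; last apply: smooth_funN => //.
    by do 2 apply: smooth_tderiv => //.
  by do 2 apply: smooth_tderiv => //.
Qed.

Lemma tderiv_coord_vfield (W : normedModType R) p q i (f : M -> W) :
  cdom (chart_at p) q -> differentiable_at f q ->
  tderiv (coord_vfield p i q) f =
  'D_(basis_vec i) (f \o cinv (chart_at p)) (cmap (chart_at p) q).
Proof.
move=> cq df; apply/esym.
have aq := chart_at_atlas q; have qq := chart_at_dom q.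
exact: (derive_change_chart _ (chart_at_atlas p) aq cq qq df).
Qed.

Lemma coord_vfield_chart p q i : cdom (chart_at p) q ->
  tderiv (coord_vfield p i q) (cmap (chart_at p)) = basis_vec i.
Proof.
move=> cq; rewrite tderiv_coord_vfield//; last first.
  by apply: cmap_differentiable_at => //; exact: chart_at_atlas.
rewrite -[RHS](derive_id (cmap (chart_at p) q)); apply: near_eq_derive.
by apply: filterS (near_chart (cdom_open _) cq cq) => y [].
Qed.

Lemma coord_vfield_at p i : coord_vfield p i p = basis_vec i.
Proof.
by rewrite -[LHS]tderiv_chart_at coord_vfield_chart//; exact: chart_at_dom.
Qed.

Lemma coord_expansion p q (v : tangent q) : cdom (chart_at p) q ->
  v = \sum_i tderiv v (cmap (chart_at p)) 0 i *: coord_vfield p i q.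
Proof.
move=> cq; rewrite -[LHS]tderiv_chart_at.
have ap := chart_at_atlas p; have aq := chart_at_atlas q.
have qq := chart_at_dom q.
have dq : differentiable_at (cmap (chart_at q)) q by exact: cmap_differentiable_at.
rewrite (tderivE _ ap cq dq) derive_basis//; exact: transition_differentiable.
Qed.

Lemma tangent_eq p q (u v : tangent q) : cdom (chart_at p) q ->
  (forall i, tderiv u (fun x => cmap (chart_at p) x 0 i) =
             tderiv v (fun x => cmap (chart_at p) x 0 i)) -> u = v.
Proof.
move=> cq uv; have ap := chart_at_atlas p.
apply: etrans (coord_expansion u cq) (etrans _ (esym (coord_expansion v cq))).
apply: eq_bigr => i _; have E : tderiv u (cmap (chart_at p)) 0 i =
    tderiv v (cmap (chart_at p)) 0 i.
  apply: etrans (tderiv_chart_fun _ _ ap cq) _.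
  exact: etrans (uv i) (esym (tderiv_chart_fun _ _ ap cq)).
by rewrite E.
Qed.

(** The components of the field in a chart [c] are partial derivatives of the
    transition map to [c]; reading them in a third chart composes them with
    another transition map. *)
Lemma smooth_coord_vfield p i :
  smooth_vfield (cdom (chart_at p)) (coord_vfield p i).
Proof.
move=> c ac j; set c0 := chart_at p.
have a0 : atlas c0 := chart_at_atlas p.
have oW : open (cdom c0 `&` cdom c) by apply: openI; exact: cdom_open.
apply: (@smooth_fun_eq _ (fun q => 'D_(basis_vec i)
   (fun y => cmap c (cinv c0 y) 0 j) (cmap c0 q))); first exact: oW.
  move=> q [c0q cq]; rewrite tderiv_coord_vfield//.
    by rewrite derive_coord//; exact: transition_differentiable.
  exact: cmap_differentiable_at.
move=> c' ac' k.
have oI : open (cmap c' @` (cdom c0 `&` cdom c `&` cdom c')).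
  exact: chart_img_open.
apply: (@diff_upto_comp _ _ k _ (cmap c0 @` (cdom c0 `&` cdom c))
  ('D_(basis_vec i) (fun y => cmap c (cinv c0 y) 0 j)) (cmap c0 \o cinv c')) => //.
- by move=> y /chart_imgP[[c0y cy] _ _]; exists (cinv c' y).
- by have [_ /(_ i)] := atlas_compat a0 ac j k.+1.
- move=> m; apply: diff_uptoS (atlas_compat ac' a0 m k).
  by move=> _ [q [[c0q _] c'q] <-]; exists q.
Qed.

End SmoothFields.

(** * Curvature of a torsion-free connection *)

Lemma add_self_eq0 (V : zmodType) (x : V) : x = x + x -> x = 0.
Proof. by move=> xx; apply: (addrI x); rewrite addr0 -xx. Qed.

(** The Lie-Rinehart algebra of the vector fields on [U], with a torsion-free
    connection: [sf] and [sv] are the smooth functions and vector fields, and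
    [act X f] is the derivative of [f] along [X].  Functions and fields are
    total; only their values on [U] matter. *)
Record field_calculus (R : realType) (d : nat) (M : Type) (U : M -> Prop)
    (sf : (M -> R) -> Prop) (sv : (M -> 'rV[R]_d) -> Prop)
    (act : (M -> 'rV[R]_d) -> (M -> R) -> M -> R)
    (br nab : (M -> 'rV[R]_d) -> (M -> 'rV[R]_d) -> M -> 'rV[R]_d) : Prop :=
  FieldCalculus {
  fc_cst : forall k, sf (fun=> k) ;
  fc_add : forall f h, sf f -> sf h -> sf (fun q => f q + h q) ;
  fc_mul : forall f h, sf f -> sf h -> sf (fun q => f q * h q) ;
  fc_act : forall X f, sv X -> sf f -> sf (act X f) ;
  fc_vadd : forall X Y, sv X -> sv Y -> sv (fun q => X q + Y q) ;
  fc_vscale : forall f X, sf f -> sv X -> sv (fun q => f q *: X q) ;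
  fc_br : forall X Y, sv X -> sv Y -> sv (br X Y) ;
  fc_nab : forall X Y, sv X -> sv Y -> sv (nab X Y) ;
  act_eq : forall X f h, (forall q, U q -> f q = h q) ->
    forall p, U p -> act X f p = act X h p ;
  act_cst : forall X k p, U p -> act X (fun=> k) p = 0 ;
  act_add : forall X f h, sf f -> sf h -> forall p, U p ->
    act X (fun q => f q + h q) p = act X f p + act X h p ;
  act_mul : forall X f h, sf f -> sf h -> forall p, U p ->
    act X (fun q => f q * h q) p = f p * act X h p + h p * act X f p ;
  act_linear : forall X Y k f, sf f -> forall p, U p ->
    act (fun q => k q *: X q + Y q) f p = k p * act X f p + act Y f p ;
  act_br : forall X Y f, sv X -> sv Y -> sf f -> forall p, U p ->
    act (br X Y) f p = act X (act Y f) p - act Y (act X f) p ;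
  act_separates : forall X Y p, U p ->
    (forall f, sf f -> act X f p = act Y f p) -> X p = Y p ;
  nab_eq : forall X X' Y Y', sv X -> sv X' -> sv Y -> sv Y' ->
    (forall q, U q -> X q = X' q) -> (forall q, U q -> Y q = Y' q) ->
    forall p, U p -> nab X Y p = nab X' Y' p ;
  nab_linear : forall f X X' Y, sf f -> sv X -> sv X' -> sv Y ->
    forall p, U p ->
    nab (fun q => f q *: X q + X' q) Y p = f p *: nab X Y p + nab X' Y p ;
  nab_add : forall X Y Y', sv X -> sv Y -> sv Y' -> forall p, U p ->
    nab X (fun q => Y q + Y' q) p = nab X Y p + nab X Y' p ;
  nab_scale : forall f X Y, sf f -> sv X -> sv Y -> forall p, U p ->
    nab X (fun q => f q *: Y q) p = act X f p *: Y p + f p *: nab X Y p ;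
  nab_torsion : forall X Y, sv X -> sv Y -> forall p, U p ->
    nab X Y p - nab Y X p = br X Y p }.

(** Vector identities whose scalars are polynomial expressions, checked
    coordinate by coordinate. *)
Ltac vring := apply/rowP => ?; rewrite !mxE; ring.

Section Curvature.
Variables (R : realType) (d : nat) (M : Type) (U : M -> Prop).
Variables (sf : (M -> R) -> Prop) (sv : (M -> 'rV[R]_d) -> Prop).
Variables (act : (M -> 'rV[R]_d) -> (M -> R) -> M -> R).
Variables (br nab : (M -> 'rV[R]_d) -> (M -> 'rV[R]_d) -> M -> 'rV[R]_d).
Hypothesis fc : field_calculus U sf sv act br nab.
Implicit Types (X Y Z W : M -> 'rV[R]_d) (f h : M -> R) (p q : M).

Definition curv X Y Z p :=
  nab X (nab Y Z) p - nab Y (nab X Z) p - nab (br X Y) Z p.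

Lemma fc_opp f : sf f -> sf (fun q => - f q).
Proof.
move=> sf_; rewrite (_ : (fun q => - f q) = (fun q => -1 * f q)).
  by apply: (fc_mul fc) => //; exact: (fc_cst fc).
by apply/funext => q; rewrite mulN1r.
Qed.

Lemma fc_vopp X : sv X -> sv (fun q => - X q).
Proof.
move=> sX; rewrite (_ : (fun q => - X q) = (fun q => -1 *: X q)).
  by apply: (fc_vscale fc _ sX); exact: (fc_cst fc).
by apply/funext => q; rewrite scaleN1r.
Qed.

Ltac smooth := repeat first
  [ assumption | apply: (fc_nab fc) | apply: (fc_br fc) | apply: (fc_act fc)
  | apply: (fc_cst fc) | apply: (fc_add fc) | apply: fc_opp | apply: (fc_mul fc)
  | apply: (fc_vadd fc) | apply: fc_vopp | apply: (fc_vscale fc) ].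

Lemma nab_opp X Y : sv X -> sv Y -> forall p, U p ->
  nab X (fun q => - Y q) p = - nab X Y p.
Proof.
move=> sX sY p Up.
have -> : (fun q => - Y q) = (fun q => -1 *: Y q).
  by apply/funext => q; rewrite scaleN1r.
rewrite (nab_scale fc)//; last exact: (fc_cst fc).
by rewrite (act_cst fc)// scale0r add0r scaleN1r.
Qed.

Lemma nab_sub X Y Z : sv X -> sv Y -> sv Z -> forall p, U p ->
  nab X (fun q => Y q - Z q) p = nab X Y p - nab X Z p.
Proof.
by move=> sX sY sZ p Up; rewrite (nab_add fc)// ?nab_opp//; smooth.
Qed.

Lemma nab_addl X Y Z : sv X -> sv Y -> sv Z -> forall p, U p ->
  nab (fun q => X q + Y q) Z p = nab X Z p + nab Y Z p.
Proof.
move=> sX sY sZ p Up.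
have -> : (fun q => X q + Y q) = (fun q => 1 *: X q + Y q).
  by apply/funext => q; rewrite scale1r.
by rewrite (nab_linear fc (fc_cst fc 1))// scale1r.
Qed.

Lemma nab_zerol X Z : sv X -> sv Z -> (forall q, U q -> X q = 0) ->
  forall p, U p -> nab X Z p = 0.
Proof.
move=> sX sZ X0 p Up; have := nab_addl sX sX sZ Up.
rewrite (nab_eq fc _ sX sZ sZ) => //; first exact: add_self_eq0.
  by smooth.
by move=> q Uq; rewrite X0// addr0.
Qed.

Lemma fc_curv X Y Z : sv X -> sv Y -> sv Z -> sv (curv X Y Z).
Proof.
move=> sX sY sZ.
exact: (fc_vadd fc (fc_vadd fc (fc_nab fc sX (fc_nab fc sY sZ))
  (fc_vopp (fc_nab fc sY (fc_nab fc sX sZ))))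
  (fc_vopp (fc_nab fc (fc_br fc sX sY) sZ))).
Qed.

Lemma br_antisym X Y : sv X -> sv Y -> forall p, U p -> br X Y p = - br Y X p.
Proof. by move=> sX sY p Up; rewrite -!(nab_torsion fc)// opprB. Qed.

Lemma act_sub X f h : sf f -> sf h -> forall p, U p ->
  act X (fun q => f q - h q) p = act X f p - act X h p.
Proof.
move=> sF sH p Up; rewrite (act_add fc)//; last exact: fc_opp.
congr (_ + _); have -> : (fun q => - h q) = (fun q => -1 * h q).
  by apply/funext => q; rewrite mulN1r.
rewrite (act_mul fc)//; last exact: (fc_cst fc).
by rewrite (act_cst fc)// mulr0 addr0 mulN1r.
Qed.

Lemma jacobi X Y Z : sv X -> sv Y -> sv Z -> forall p, U p ->
  br X (br Y Z) p + br Y (br Z X) p + br Z (br X Y) p = 0.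
Proof.
move=> sX sY sZ p Up.
pose S q := 1 *: br X (br Y Z) q + br Y (br Z X) q.
pose T q := 1 *: S q + br Z (br X Y) q.
have H : T p = 0.
  apply: (act_separates fc (X := T) (Y := fun=> 0)) => // f sF.
  rewrite (act_linear fc _ _ (fun=> 1))// (act_linear fc _ _ (fun=> 1))//.
  have a0 : act (fun=> 0) f p = 0.
    have := act_linear fc (fun=> 0) (fun=> 0) (fun=> 1) sF Up.
    have -> : (fun q : M => (1 : R) *: (0 : 'rV[R]_d) + 0) = fun=> 0.
      by apply/funext => q; rewrite scaler0 addr0.
    by rewrite mul1r; exact: add_self_eq0.
  have E (A B C : M -> 'rV[R]_d) : sv A -> sv B -> sv C ->
    act (br A (br B C)) f p = act A (act B (act C f)) p -
      act A (act C (act B f)) p - (act B (act C (act A f)) p -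
      act C (act B (act A f)) p).
    move=> sA sB sC; rewrite (act_br fc)//; last by smooth.
    rewrite (act_br fc sB sC _ Up); last by smooth.
    rewrite -act_sub//; [|by smooth..].
    congr (_ - _); apply: (act_eq fc) => // q Uq; exact: (act_br fc).
  rewrite a0 !E//; ring.
by move: H; rewrite /T /S !scale1r.
Qed.

(** The second Bianchi identity in operator form: the Jacobi identity for the
    commutators of [nab W], [nab X] and [nab Y], combined with the one for the
    bracket of vector fields. *)
Lemma second_bianchi W X Y Z : sv W -> sv X -> sv Y -> sv Z -> forall p, U p ->
  (nab W (curv X Y Z) p - curv X Y (nab W Z) p + curv W (br X Y) Z p) +
  (nab X (curv Y W Z) p - curv Y W (nab X Z) p + curv X (br Y W) Z p) +
  (nab Y (curv W X Z) p - curv W X (nab Y Z) p + curv Y (br W X) Z p) = 0.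
Proof.
move=> sW sX sY sZ p Up.
have E A B C : sv A -> sv B -> sv C -> nab A (curv B C Z) p =
    nab A (nab B (nab C Z)) p - nab A (nab C (nab B Z)) p -
    nab A (nab (br B C) Z) p.
  by move=> sA sB sC; rewrite /curv !nab_sub//; smooth.
have J : nab (br W (br X Y)) Z p + nab (br X (br Y W)) Z p +
         nab (br Y (br W X)) Z p = 0.
  rewrite -!nab_addl//; [|by smooth..].
  apply: nab_zerol => //; first by smooth.
  by move=> q Uq; exact: jacobi.
rewrite !E// /curv; apply: etrans (oppr0 _); rewrite -J; vring.
Qed.

Lemma first_bianchi X Y Z : sv X -> sv Y -> sv Z -> forall p, U p ->
  curv X Y Z p + curv Y Z X p + curv Z X Y p = 0.
Proof.
move=> sX sY sZ p Up.
have E A B C : sv A -> sv B -> sv C ->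
    nab A (nab B C) p - nab A (nab C B) p - nab (br B C) A p = br A (br B C) p.
  move=> sA sB sC; rewrite -(nab_torsion fc)//; last by smooth.
  rewrite -nab_sub//; [|by smooth..].
  congr (_ - _); apply: (nab_eq fc) => //; [by smooth..|].
  by move=> q Uq; exact: (nab_torsion fc).
rewrite -(jacobi sX sY sZ Up) -!E// /curv; vring.
Qed.

Lemma curv_antisym X Y Z : sv X -> sv Y -> sv Z -> forall p, U p ->
  curv X Y Z p = - curv Y X Z p.
Proof.
move=> sX sY sZ p Up; rewrite /curv.
have -> : nab (br X Y) Z p = - nab (br Y X) Z p.
  apply/eqP; rewrite -subr_eq0 opprK -nab_addl//; [|by smooth..].
  apply/eqP/nab_zerol => //; first by smooth.
  by move=> q Uq; rewrite br_antisym// addNr.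
vring.
Qed.

Lemma curv_linear f X X' Y Z : sf f -> sv X -> sv X' -> sv Y -> sv Z ->
  forall p, U p ->
  curv (fun q => f q *: X q + X' q) Y Z p = f p *: curv X Y Z p + curv X' Y Z p.
Proof.
move=> sF sX sX' sY sZ p Up; rewrite /curv (nab_linear fc)//; [|by smooth..].
rewrite (nab_eq fc _ _ _ _ _ _ Up (Y' := fun q => f q *: nab X Z q + nab X' Z q)
  (Y := nab (fun q => f q *: X q + X' q) Z) (X := Y) (X' := Y))//; try by smooth.
  rewrite (nab_add fc)// ?(nab_scale fc)//; try by smooth.
  rewrite (nab_eq fc _ _ _ _ _ _ Up (X := br (fun q => f q *: X q + X' q) Y)
    (X' := fun q => f q *: br X Y q + (- act Y f q *: X q + br X' Y q))
    (Y := Z) (Y' := Z))//; try by smooth.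
    rewrite (nab_linear fc)//; try by smooth.
    rewrite (nab_linear fc (f := fun q => - act Y f q))//; try by smooth.
    vring.
  move=> q Uq; rewrite -!(nab_torsion fc)//; try by smooth.
  rewrite (nab_linear fc)// (nab_add fc)//; try by smooth.
  rewrite (nab_scale fc)//; vring.
by move=> q Uq; exact: (nab_linear fc).
Qed.

Lemma curvE X Y Z p : curv X Y Z p =
  nab X (nab Y Z) p - nab Y (nab X Z) p - nab (br X Y) Z p.
Proof. by []. Qed.

Lemma curv_eql X X' Y Z : sv X -> sv X' -> sv Y -> sv Z ->
  (forall q, U q -> X q = X' q) -> forall p, U p -> curv X Y Z p = curv X' Y Z p.
Proof.
move=> sX sX' sY sZ XX p Up; rewrite /curv; congr (_ - _ - _).
- by apply: (nab_eq fc) => //; smooth.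
- apply: (nab_eq fc) => //; [by smooth..|].
  by move=> q Uq; apply: (nab_eq fc).
- apply: (nab_eq fc) => //; [by smooth..|].
  move=> q Uq; rewrite -!(nab_torsion fc)//; congr (_ - _).
    exact: (nab_eq fc).
  exact: (nab_eq fc).
Qed.

Lemma curv_addl X X' Y Z : sv X -> sv X' -> sv Y -> sv Z ->
  forall p, U p ->
  curv (fun q => X q + X' q) Y Z p = curv X Y Z p + curv X' Y Z p.
Proof.
move=> sX sX' sY sZ p Up; rewrite -[curv X Y Z p]scale1r.
rewrite -(curv_linear (fc_cst fc 1) sX sX' sY sZ Up); apply: curv_eql => //.
- by smooth.
- by smooth.
- by move=> q _; rewrite scale1r.
Qed.

Lemma curv_scalel f X Y Z : sf f -> sv X -> sv Y -> sv Z ->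
  forall p, U p -> curv (fun q => f q *: X q) Y Z p = f p *: curv X Y Z p.
Proof.
move=> sF sX sY sZ p Up; have s0 : sv (fun q => 0 *: X q) by smooth.
have c0 : curv (fun q => 0 *: X q) Y Z p = 0.
  apply: add_self_eq0; rewrite -curv_addl//; apply: curv_eql => //.
    by smooth.
  by move=> q _; rewrite scale0r addr0.
rewrite -[RHS]addr0 -c0 -(curv_linear sF sX s0 sY sZ Up).
apply: curv_eql => //; [by smooth..|].
by move=> q _; rewrite scale0r addr0.
Qed.

Lemma curv_oppl X Y Z : sv X -> sv Y -> sv Z -> forall p, U p ->
  curv (fun q => - X q) Y Z p = - curv X Y Z p.
Proof.
move=> sX sY sZ p Up; rewrite -scaleN1r.
rewrite -(curv_scalel (fc_cst fc (-1)) sX sY sZ Up).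
apply: curv_eql => //; [by smooth..|].
by move=> q _; rewrite scaleN1r.
Qed.

End Curvature.

Ltac smooth_step fc := first
  [ assumption | apply: (fc_curv fc) | apply: (fc_nab fc) | apply: (fc_br fc)
  | apply: (fc_act fc) | apply: (fc_cst fc) | apply: (fc_add fc)
  | apply: (fc_opp fc) | apply: (fc_mul fc) | apply: (fc_vadd fc)
  | apply: (fc_vopp fc) | apply: (fc_vscale fc) ].


(** * Metric connections and traces *)

Record metric_calculus (R : realType) (d : nat) (M : Type) (U : M -> Prop)
    (sf : (M -> R) -> Prop) (sv : (M -> 'rV[R]_d) -> Prop)
    (act : (M -> 'rV[R]_d) -> (M -> R) -> M -> R)
    (br nab : (M -> 'rV[R]_d) -> (M -> 'rV[R]_d) -> M -> 'rV[R]_d)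
    (g : M -> 'rV[R]_d -> 'rV[R]_d -> R) : Prop := MetricCalculus {
  mc_calculus : field_calculus U sf sv act br nab ;
  mc_sym : forall p u v, g p u v = g p v u ;
  mc_linear : forall p u k v w, g p u (k *: v + w) = k * g p u v + g p u w ;
  mc_pos : forall p v, v != 0 -> 0 < g p v v ;
  mc_smooth : forall X Y, sv X -> sv Y -> sf (fun q => g q (X q) (Y q)) ;
  mc_nab : forall X Y Z, sv X -> sv Y -> sv Z -> forall p, U p ->
    act X (fun q => g q (Y q) (Z q)) p =
    g p (nab X Y p) (Z p) + g p (Y p) (nab X Z p) }.

Record frame_calculus (R : realType) (d : nat) (M : Type) (U : M -> Prop)
    (sf : (M -> R) -> Prop) (sv : (M -> 'rV[R]_d) -> Prop)
    (E : 'I_d -> M -> 'rV[R]_d) (th : 'I_d -> M -> 'rV[R]_d -> R) : Prop :=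
  FrameCalculus {
  fr_smooth : forall i, sv (E i) ;
  fr_component : forall i X, sv X -> sf (fun q => th i q (X q)) ;
  fr_linear : forall i k u v p, U p ->
    th i p (k *: u + v) = k * th i p u + th i p v ;
  fr_dual : forall i j p, U p -> th j p (E i p) = (i == j)%:R ;
  fr_expansion : forall p v, U p -> v = \sum_i th i p v *: E i p }.

Section Metric.
Variables (R : realType) (d : nat) (M : Type) (U : M -> Prop).
Variables (sf : (M -> R) -> Prop) (sv : (M -> 'rV[R]_d) -> Prop).
Variables (act : (M -> 'rV[R]_d) -> (M -> R) -> M -> R).
Variables (br nab : (M -> 'rV[R]_d) -> (M -> 'rV[R]_d) -> M -> 'rV[R]_d).
Variables (g : M -> 'rV[R]_d -> 'rV[R]_d -> R).
Hypothesis mc : metric_calculus U sf sv act br nab g.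
Let fc : field_calculus U sf sv act br nab := mc_calculus mc.
Local Notation Rm := (curv br nab).
Implicit Types (X Y Z W : M -> 'rV[R]_d) (f h : M -> R) (p q : M).

Ltac smooth := repeat first [ smooth_step fc | apply: (mc_smooth mc) ].

Lemma g0r p u : g p u 0 = 0.
Proof.
by have := mc_linear mc p u 1 0 0; rewrite scaler0 addr0 mul1r => /add_self_eq0.
Qed.

Lemma gZr p u k v : g p u (k *: v) = k * g p u v.
Proof. by rewrite -[k *: v]addr0 (mc_linear mc) g0r addr0. Qed.

Lemma gDr p u v w : g p u (v + w) = g p u v + g p u w.
Proof. by rewrite -[v]scale1r (mc_linear mc) mul1r scale1r. Qed.

Lemma gNr p u v : g p u (- v) = - g p u v.
Proof. by rewrite -scaleN1r gZr mulN1r. Qed.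

Lemma gZl p k u v : g p (k *: u) v = k * g p u v.
Proof. by rewrite (mc_sym mc) gZr (mc_sym mc). Qed.

Lemma gDl p u v w : g p (u + v) w = g p u w + g p v w.
Proof. by rewrite (mc_sym mc) gDr !(mc_sym mc p w). Qed.

Lemma gNl p u v : g p (- u) v = - g p u v.
Proof. by rewrite (mc_sym mc) gNr (mc_sym mc). Qed.

Definition gE := (gDl, gNl, gZl, gDr, gNr, gZr).

Lemma g_nondegenerate p u v : (forall w, g p u w = g p v w) -> u = v.
Proof.
move=> uv; apply/eqP; rewrite -subr_eq0; apply/negPn/negP => /(mc_pos mc p).
by rewrite gDl gNl uv subrr ltxx.
Qed.

(** The commutator of the derivations [X] and [Y] applied to [g(Z,W)] is
    [[X,Y] g(Z,W)]. *)
Lemma curv_skew X Y Z W : sv X -> sv Y -> sv Z -> sv W -> forall p, U p ->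
  g p (Rm X Y Z p) (W p) + g p (Z p) (Rm X Y W p) = 0.
Proof.
move=> sX sY sZ sW p Up.
have E A B : sv A -> sv B -> act A (act B (fun q => g q (Z q) (W q))) p =
   g p (nab A (nab B Z) p) (W p) + g p (nab B Z p) (nab A W p) +
   (g p (nab A Z p) (nab B W p) + g p (Z p) (nab A (nab B W) p)).
  move=> sA sB.
  rewrite (act_eq fc _ (h := fun q => g q (nab B Z q) (W q) +
    g q (Z q) (nab B W q)) _ Up); last first.
    by move=> q Uq; rewrite (mc_nab mc).
  rewrite (act_add fc)//; try by smooth.
  by rewrite !(mc_nab mc)//; smooth.
have := act_br fc sX sY (mc_smooth mc sZ sW) Up.
rewrite !E// (mc_nab mc)//; last by smooth.
move=> H; rewrite !curvE !gE; lra.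
Qed.

Section Frame.
Variables (E : 'I_d -> M -> 'rV[R]_d) (th : 'I_d -> M -> 'rV[R]_d -> R).
Hypothesis fr : frame_calculus U sf sv E th.

Lemma th0 i p : U p -> th i p 0 = 0.
Proof.
move=> Up; have := fr_linear fr i 1 0 0 Up.
by rewrite scaler0 addr0 mul1r => /add_self_eq0.
Qed.

Lemma thZ i p k u : U p -> th i p (k *: u) = k * th i p u.
Proof. by move=> Up; rewrite -[k *: u]addr0 (fr_linear fr)// th0// addr0. Qed.

Lemma thD i p u v : U p -> th i p (u + v) = th i p u + th i p v.
Proof. by move=> Up; rewrite -[u]scale1r (fr_linear fr)// mul1r scale1r. Qed.

Lemma thN i p u : U p -> th i p (- u) = - th i p u.
Proof. by move=> Up; rewrite -scaleN1r thZ// mulN1r. Qed.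

Lemma th_sum i p (F : 'I_d -> 'rV[R]_d) : U p ->
  th i p (\sum_j F j) = \sum_j th i p (F j).
Proof.
move=> Up; rewrite (big_morph (th i p) (id1 := 0) (op1 := +%R))//.
- by move=> u v; rewrite thD.
- exact: th0.
Qed.

Lemma act_zero X : forall p, U p -> act X (fun=> 0) p = 0.
Proof. by move=> p Up; rewrite (act_cst fc). Qed.

Lemma smooth_zero X : sv X -> sv (fun=> 0).
Proof.
move=> sX; have -> : (fun=> 0) = (fun q => 0 *: X q).
  by apply/funext => q; rewrite scale0r.
by smooth.
Qed.

Lemma smooth_sum (s : seq 'I_d) (f : 'I_d -> M -> R)
    (Y : 'I_d -> M -> 'rV[R]_d) X : sv X ->
  (forall i, sf (f i)) -> (forall i, sv (Y i)) ->
  sv (fun q => \sum_(i <- s) f i q *: Y i q).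
Proof.
move=> sX sF sY; elim: s => [|j s IH].
  rewrite (_ : (fun _ => _) = fun=> 0); first exact: smooth_zero sX.
  by apply/funext => q; rewrite big_nil.
rewrite (_ : (fun _ => _) = fun q => f j q *: Y j q +
    \sum_(i <- s) f i q *: Y i q); last first.
  by apply/funext => q; rewrite big_cons.
by smooth; [exact: sF|exact: sY].
Qed.

Lemma smooth_fsum (s : seq 'I_d) (f : 'I_d -> M -> R) :
  (forall i, sf (f i)) -> sf (fun q => \sum_(i <- s) f i q).
Proof.
move=> sF; elim: s => [|j s IH].
  rewrite (_ : (fun _ => _) = fun=> 0); first exact: (fc_cst fc).
  by apply/funext => q; rewrite big_nil.
rewrite (_ : (fun _ => _) = fun q => f j q + \sum_(i <- s) f i q); last first.
  by apply/funext => q; rewrite big_cons.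
by smooth; exact: sF.
Qed.

Lemma act_sum X (f : 'I_d -> M -> R) : (forall i, sf (f i)) -> forall p, U p ->
  act X (fun q => \sum_i f i q) p = \sum_i act X (f i) p.
Proof.
move=> sF p Up; elim: (index_enum _) => [|j s IH].
  rewrite big_nil; apply: etrans (act_zero X Up); congr (act X _ p).
  by apply/funext => q; rewrite big_nil.
rewrite big_cons -IH -(act_add fc)//; last exact: smooth_fsum.
by congr (act X _ p); apply/funext => q; rewrite big_cons.
Qed.

Lemma nab_sum X (f : 'I_d -> M -> R) (Y : 'I_d -> M -> 'rV[R]_d) : sv X ->
  (forall i, sf (f i)) -> (forall i, sv (Y i)) -> forall p, U p ->
  nab X (fun q => \sum_i f i q *: Y i q) p =
  \sum_i (act X (f i) p *: Y i p + f i p *: nab X (Y i) p).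
Proof.
move=> sX sF sY p Up; elim: (index_enum _) => [|j s IH].
  rewrite big_nil; have -> : (fun q => \sum_(i <- [::]) f i q *: Y i q) =
      (fun q => 0 *: X q).
    by apply/funext => q; rewrite big_nil scale0r.
  rewrite (nab_scale fc)//; last exact: (fc_cst fc).
  by rewrite act_zero// !scale0r addr0.
rewrite big_cons -IH -(nab_scale fc)// -(nab_add fc)//.
- by congr (nab X _ p); apply/funext => q; rewrite big_cons.
- exact: (fc_vscale fc).
- exact: (smooth_sum _ sX sF sY).
Qed.

(** The operators on vector fields that are linear over the smooth functions,
    i.e. the endomorphisms of the tangent bundle over [U]. *)
Definition tensorial (A : (M -> 'rV[R]_d) -> M -> 'rV[R]_d) :=
  [/\ forall X, sv X -> sv (A X),
      forall X X', sv X -> sv X' -> (forall q, U q -> X q = X' q) ->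
        forall p, U p -> A X p = A X' p &
      forall f X X', sf f -> sv X -> sv X' -> forall p, U p ->
        A (fun q => f q *: X q + X' q) p = f p *: A X p + A X' p].

Lemma tensorial_sum A (f : 'I_d -> M -> R) (Y : 'I_d -> M -> 'rV[R]_d) :
  tensorial A -> (forall i, sf (f i)) -> (forall i, sv (Y i)) ->
  forall X, sv X -> (forall q, U q -> X q = \sum_i f i q *: Y i q) ->
  forall p, U p -> A X p = \sum_i f i p *: A (Y i) p.
Proof.
move=> [_ Aeq Alin] sF sY X sX XE p Up.
rewrite (Aeq X (fun q => \sum_i f i q *: Y i q))//; last first.
  exact: (smooth_sum _ sX sF sY).
elim: (index_enum _) => [|j s IH].
  rewrite big_nil; have s0 := smooth_zero sX.
  rewrite (_ : (fun _ => _) = fun=> 0); last first.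
    by apply/funext => q; rewrite big_nil.
  apply: add_self_eq0; have := Alin (fun=> 1) _ _ (fc_cst fc 1) s0 s0 p Up.
  rewrite [_ *: A _ p]scale1r => AE; apply: etrans _ AE.
  apply: Aeq => //; last by move=> q _; rewrite scale1r addr0.
  by smooth.
rewrite big_cons -IH -Alin//; last exact: (smooth_sum _ sX sF sY).
by congr (A _ _); apply/funext => q; rewrite big_cons.
Qed.

Definition trace (A : (M -> 'rV[R]_d) -> M -> 'rV[R]_d) p :=
  \sum_j th j p (A (E j) p).

(** The derivatives of the frame contribute the trace of the commutator of two
    matrices, that of [A] and that of [nab X] on the frame, which is zero. *)
Lemma trace_nab A X : tensorial A -> sv X -> forall p, U p ->
  \sum_j th j p (nab X (A (E j)) p - A (nab X (E j)) p) = act X (trace A) p.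
Proof.
move=> tA sX p Up; have [sA Aeq Alin] := tA; have sE := fr_smooth fr.
pose a j i q := th i q (A (E j) q).
pose b j i q := th i q (nab X (E j) q).
have sa j i : sf (a j i) by apply: (fr_component fr); exact: sA.
have sb j i : sf (b j i) by apply: (fr_component fr); exact: (fc_nab fc).
have E1 j : nab X (A (E j)) p =
    \sum_i (act X (a j i) p *: E i p + a j i p *: nab X (E i) p).
  rewrite -nab_sum//; apply: (nab_eq fc) => //.
  - exact: sA.
  - exact: (smooth_sum _ sX).
  - by move=> q Uq; exact: (fr_expansion fr).
have E2 j : A (nab X (E j)) p = \sum_i b j i p *: A (E i) p.
  apply: (tensorial_sum tA) => //; first exact: (fc_nab fc).
  by move=> q Uq; exact: (fr_expansion fr).
have E3 j : th j p (nab X (A (E j)) p - A (nab X (E j)) p) =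
    act X (a j j) p + (\sum_i a j i p * b i j p - \sum_i b j i p * a i j p).
  rewrite thD// thN// E1 E2 !th_sum// addrA; congr (_ - _); last first.
    by apply: eq_bigr => i _; rewrite thZ.
  rewrite (eq_bigr (fun i => act X (a j i) p * (i == j)%:R + a j i p * b i j p)).
    rewrite big_split/=; congr (_ + _).
    rewrite (bigD1 j)//= eqxx mulr1 big1 ?addr0// => i /negPf->.
    by rewrite mulr0.
  by move=> i _; rewrite thD// !thZ// (fr_dual fr).
rewrite (eq_bigr _ (fun j _ => E3 j)) big_split/= sumrB.
rewrite [X in _ - X]exchange_big/= [X in X - _](eq_bigr (fun j =>
  \sum_i b i j p * a j i p)); last first.
  by move=> j _; apply: eq_bigr => i _; rewrite mulrC.
by rewrite subrr addr0 -act_sum.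
Qed.

End Frame.
End Metric.

(** * Kenmotsu curvature identities and eta-Ricci solitons *)

Section Kenmotsu.
Variables (R : realType) (d : nat) (M : Type) (U : M -> Prop).
Variables (sf : (M -> R) -> Prop) (sv : (M -> 'rV[R]_d) -> Prop).
Variables (act : (M -> 'rV[R]_d) -> (M -> R) -> M -> R).
Variables (br nab : (M -> 'rV[R]_d) -> (M -> 'rV[R]_d) -> M -> 'rV[R]_d).
Variables (g : M -> 'rV[R]_d -> 'rV[R]_d -> R).
Hypothesis mc : metric_calculus U sf sv act br nab g.
Let fc : field_calculus U sf sv act br nab := mc_calculus mc.
Local Notation Rm := (curv br nab).
Variables (E : 'I_d -> M -> 'rV[R]_d) (th : 'I_d -> M -> 'rV[R]_d -> R).
Hypothesis fr : frame_calculus U sf sv E th.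
Variable xi : M -> 'rV[R]_d.
Hypothesis sxi : sv xi.
Hypothesis g_xi : forall p, g p (xi p) (xi p) = 1.
Hypothesis nab_xi : forall X, sv X -> forall p, U p ->
  nab X xi p = X p - g p (X p) (xi p) *: xi p.
Implicit Types (X Y Z W : M -> 'rV[R]_d) (f h : M -> R) (p q : M).

Local Notation eta p v := (g p v (xi p)).
Local Notation gE := (gE mc).

Ltac smooth := repeat first
  [ smooth_step fc | apply: (mc_smooth mc) | apply: (fr_smooth fr) ].

(** By this an identity between fields, once paired with [g] against all smooth
    fields, holds at each point by the nondegeneracy of [g]. *)
Lemma smooth_extension p u : U p -> exists2 W, sv W & W p = u.
Proof.
move=> Up; exists (fun q => \sum_i th i p u *: E i q).
  apply: (smooth_sum mc _ sxi); last exact: (fr_smooth fr).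
  by move=> i; exact: (fc_cst fc).
exact/esym/(fr_expansion fr).
Qed.

Lemma act_eta X Y : sv X -> sv Y -> forall p, U p ->
  act X (fun q => eta q (Y q)) p =
  eta p (nab X Y p) + g p (X p) (Y p) - eta p (X p) * eta p (Y p).
Proof.
move=> sX sY p Up; rewrite (mc_nab mc)// nab_xi// !gE.
rewrite (mc_sym mc p (Y p) (X p)); ring.
Qed.

Lemma curv_xi X Y : sv X -> sv Y -> forall p, U p ->
  Rm X Y xi p = eta p (X p) *: Y p - eta p (Y p) *: X p.
Proof.
move=> sX sY p Up.
have H A B : sv A -> sv B -> nab A (nab B xi) p =
    nab A B p - (eta p (nab A B p) + g p (A p) (B p) - eta p (A p) * eta p (B p))
      *: xi p - eta p (B p) *: (A p - eta p (A p) *: xi p).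
  move=> sA sB; rewrite (nab_eq fc (Y' := fun q => B q - eta q (B q) *: xi q)
    (X' := A))//; [|by smooth..|by move=> q Uq; exact: nab_xi].
  rewrite (nab_sub fc)//; last by smooth.
  rewrite (nab_scale fc)//; last by smooth.
  by rewrite act_eta// nab_xi// opprD addrA.
rewrite curvE !H// nab_xi//; last by smooth.
rewrite -(nab_torsion fc)// !gE (mc_sym mc p (Y p) (X p)); vring.
Qed.

(** Let [Q] be the difference of the two sides, paired with a third field.  It
    is symmetric in its first two arguments by the first Bianchi identity and
    [curv_xi], and skew in its last two, hence zero. *)
Lemma curv_xil Y Z : sv Y -> sv Z -> forall p, U p ->
  Rm xi Y Z p = eta p (Z p) *: Y p - g p (Y p) (Z p) *: xi p.
Proof.
move=> sY sZ p Up; apply: (g_nondegenerate mc (p := p)) => w.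
have [W sW <-] := smooth_extension w Up.
pose Q A B C := g p (Rm xi A B p) (C p) - eta p (B p) * g p (A p) (C p) +
  g p (A p) (B p) * eta p (C p).
have skew A B C : sv A -> sv B -> sv C -> Q A B C = - Q A C B.
  move=> sA sB sC; have := curv_skew mc sxi sA sB sC Up.
  rewrite /Q (mc_sym mc p (B p) (Rm _ _ _ _)); lra.
have symm A B C : sv A -> sv B -> sv C -> Q A B C = Q B A C.
  move=> sA sB sC; have := first_bianchi fc sxi sA sB Up.
  rewrite curv_xi// (curv_antisym fc sB sxi sA Up) => H.
  have := g0r mc p (C p); rewrite -[in g p _ _]H (mc_sym mc) !gE => H'.
  rewrite /Q (mc_sym mc p (B p) (A p)) !curvE !gE; lra.
have Q0 : Q Y Z W = 0.
  have e1 := symm _ _ _ sY sZ sW; have e2 := skew _ _ _ sZ sY sW.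
  have e3 := symm _ _ _ sZ sW sY; have e4 := skew _ _ _ sW sZ sY.
  have e5 := symm _ _ _ sW sY sZ; have e6 := skew _ _ _ sY sW sZ; lra.
move: Q0; rewrite /Q !curvE !gE (mc_sym mc p (xi p)); lra.
Qed.

(** The second Bianchi identity for [xi], [X], [Y].  Two of its three cyclic
    terms involve curvatures with an argument [xi], which [curv_xil] makes
    explicit. *)
Lemma radial_bianchi X Y Z : sv X -> sv Y -> sv Z -> forall p, U p ->
  nab xi (Rm X Y Z) p - Rm (nab xi X) Y Z p =
  - Rm X Y Z p + Rm X Y (nab xi Z) p - Rm X (br Y xi) Z p +
  2 * g p (X p) (Z p) *: Y p +
  (eta p (Y p) * eta p (Z p) - 2 * g p (Y p) (Z p)) *: X p -
  g p (X p) (Z p) * eta p (Y p) *: xi p.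
Proof.
move=> sX sY sZ p Up.
have := second_bianchi fc sxi sX sY sZ Up.
have -> : Rm Y (br xi X) Z p = - Rm (nab xi X) Y Z p + Rm X Y Z p -
    eta p (X p) *: Rm xi Y Z p.
  rewrite (curv_antisym fc)//; try by smooth.
  rewrite (curv_eql fc _ _ sY sZ _ Up (X' := fun q =>
    nab xi X q + (- X q + eta q (X q) *: xi q)))//; try by smooth.
    do 2 (rewrite (curv_addl fc)//; try by smooth).
    rewrite (curv_oppl fc)// (curv_scalel fc)//; try by smooth.
    vring.
  move=> q Uq; rewrite -(nab_torsion fc)// nab_xi//; vring.
have -> : nab X (Rm Y xi Z) p =
    (g p (nab X Y p) (Z p) + g p (Y p) (nab X Z p)) *: xi p +
    g p (Y p) (Z p) *: (X p - eta p (X p) *: xi p) -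
    (eta p (nab X Z p) + g p (X p) (Z p) - eta p (X p) * eta p (Z p)) *: Y p -
    eta p (Z p) *: nab X Y p.
  rewrite (nab_eq fc (Y' := fun q =>
    g q (Y q) (Z q) *: xi q - eta q (Z q) *: Y q) (X' := X))//; try by smooth.
    rewrite (nab_sub fc)//; try by smooth.
    do 2 (rewrite (nab_scale fc)//; try by smooth).
    rewrite act_eta// (mc_nab mc)// nab_xi//; vring.
  by move=> q Uq; rewrite (curv_antisym fc)// curv_xil// opprB.
have -> : nab Y (Rm xi X Z) p =
    (eta p (nab Y Z p) + g p (Y p) (Z p) - eta p (Y p) * eta p (Z p)) *: X p +
    eta p (Z p) *: nab Y X p -
    (g p (nab Y X p) (Z p) + g p (X p) (nab Y Z p)) *: xi p -
    g p (X p) (Z p) *: (Y p - eta p (Y p) *: xi p).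
  rewrite (nab_eq fc (Y' := fun q =>
    eta q (Z q) *: X q - g q (X q) (Z q) *: xi q) (X' := Y))//; try by smooth.
    rewrite (nab_sub fc)//; try by smooth.
    do 2 (rewrite (nab_scale fc)//; try by smooth).
    rewrite act_eta// (mc_nab mc)// nab_xi//; vring.
  by move=> q Uq; exact: curv_xil.
rewrite (curv_antisym fc (X := Y) (Y := xi))//; try by smooth.
rewrite !curv_xil//; try by smooth.
rewrite -(nab_torsion fc)// !gE.
move=> H; apply/eqP; rewrite -subr_eq0 -[X in _ == X]H; apply/eqP; vring.
Qed.

Definition ric Y Z p := trace E th (fun X => Rm X Y Z) p.

Lemma sum_dual_trace p u v : U p -> \sum_j g p (E j p) v * th j p u = g p u v.
Proof.
move=> Up; rewrite [in RHS](fr_expansion fr u Up) (mc_sym mc).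
rewrite (big_morph (g p v) (id1 := 0) (op1 := +%R)).
- by apply: eq_bigr => j _; rewrite (gZr mc) mulrC (mc_sym mc).
- exact: (gDr mc).
- exact: (g0r mc).
Qed.

Lemma sum_dual_id p : U p -> \sum_j th j p (E j p) = d%:R.
Proof.
move=> Up; rewrite (eq_bigr (fun=> 1)); first by rewrite sumr_const card_ord.
by move=> j _; rewrite (fr_dual fr)// eqxx.
Qed.

Lemma ric_xi Y : sv Y -> forall p, U p ->
  ric Y xi p = (1 - d%:R) * eta p (Y p).
Proof.
move=> sY p Up; rewrite mulrBl mul1r -[X in X - _](sum_dual_trace _ _ Up).
rewrite -(sum_dual_id Up) mulr_suml -sumrB; apply: eq_bigr => j _.
rewrite curv_xi//; last by smooth.
rewrite (thD fr)// (thN fr)// !(thZ fr)//; ring.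
Qed.

Lemma tensorial_curv Y Z : sv Y -> sv Z ->
  tensorial U sf sv (fun X => Rm X Y Z).
Proof.
move=> sY sZ; split.
- by move=> X sX; smooth.
- by move=> X X' sX sX' XX p Up; exact: (curv_eql fc).
- by move=> f X X' sF sX sX' p Up; exact: (curv_linear fc).
Qed.

(** The trace of [radial_bianchi] over [X].  Expanding
    [[Y,xi] = Y - eta(Y) xi - nab xi Y] and using the value of [Ric(xi,Z)]
    turns this into [nab_xi Ric = - 2 Ric - 2 (d - 1) g]. *)
Lemma radial_ric Y Z : sv Y -> sv Z -> forall p, U p ->
  act xi (ric Y Z) p = - ric Y Z p + ric Y (nab xi Z) p - ric (br Y xi) Z p +
  (2 - 2 * d%:R) * g p (Y p) (Z p) +
  (d%:R - 1) * (eta p (Y p) * eta p (Z p)).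
Proof.
move=> sY sZ p Up.
rewrite -(trace_nab mc fr (tensorial_curv sY sZ) sxi Up) /ric /trace.
pose a := eta p (Y p) * eta p (Z p) - 2 * g p (Y p) (Z p).
pose s1 := \sum_j th j p (Rm (E j) Y Z p).
pose s2 := \sum_j th j p (Rm (E j) Y (nab xi Z) p).
pose s3 := \sum_j th j p (Rm (E j) (br Y xi) Z p).
pose s4 := \sum_j g p (E j p) (Z p) * th j p (Y p).
pose s5 := \sum_j th j p (E j p).
pose s6 := \sum_j g p (E j p) (Z p) * th j p (xi p).
rewrite [LHS](_ : _ = - s1 + s2 - s3 + 2 * s4 + a * s5 - eta p (Y p) * s6).
  rewrite /s4 /s5 /s6 !sum_dual_trace// sum_dual_id//.
  rewrite (mc_sym mc p (xi p)) /a /s1 /s2 /s3; ring.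
rewrite /s1 /s2 /s3 /s4 /s5 /s6 !mulr_sumr -!sumrN -!big_split/=.
apply: eq_bigr => j _; rewrite radial_bianchi//; last by smooth.
do 5 rewrite (thD fr)//; rewrite !(thN fr)// !(thZ fr)// /a; ring.
Qed.

Section Soliton.
Variables (sigma : M -> R) (lambda mu : R).
Hypothesis ssigma : sf sigma.
Let V q := sigma q *: xi q.
Hypothesis soliton : forall X Y, sv X -> sv Y -> forall p, U p ->
  2^-1 * (act V (fun q => g q (X q) (Y q)) p - g p (br V X p) (Y p)
          - g p (X p) (br V Y p)) + ric X Y p +
  lambda * g p (X p) (Y p) + mu * (eta p (X p) * eta p (Y p)) = 0.

Let sV : sv V. Proof. by rewrite /V; smooth. Qed.
Let c : R := d%:R - 1 - lambda - mu.

Lemma soliton_lie X Y : sv X -> sv Y -> forall p, U p ->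
  act V (fun q => g q (X q) (Y q)) p - g p (br V X p) (Y p)
    - g p (X p) (br V Y p) =
  act X sigma p * eta p (Y p) + act Y sigma p * eta p (X p) +
  2 * sigma p * (g p (X p) (Y p) - eta p (X p) * eta p (Y p)).
Proof.
move=> sX sY p Up; rewrite (mc_nab mc)// -!(nab_torsion fc)//.
rewrite !(nab_scale fc)// !nab_xi// !gE.
rewrite (mc_sym mc p (xi p)) (mc_sym mc p (X p) (xi p)).
by rewrite (mc_sym mc p (X p) (Y p)); ring.
Qed.

(** On [(X, xi)] the soliton equation is an expression of [X sigma] by
    [xi sigma] and [eta(X)]; taking [X = xi] gives [xi sigma = c]. *)
Lemma soliton_xi X : sv X -> forall p, U p ->
  act X sigma p = c * eta p (X p).
Proof.
move=> sX p Up.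
have H A : sv A -> 2^-1 * (act A sigma p + act xi sigma p * eta p (A p)) =
    c * eta p (A p).
  move=> sA; have := soliton sA sxi Up.
  rewrite soliton_lie// ric_xi// g_xi /c; lra.
have := H xi sxi; rewrite g_xi => Hxi; have := H X sX.
have -> : act xi sigma p = c by lra.
lra.
Qed.

Lemma soliton_ric X Y : sv X -> sv Y -> forall p, U p ->
  ric X Y p = - (sigma p + lambda) * g p (X p) (Y p) +
    (sigma p - c - mu) * (eta p (X p) * eta p (Y p)).
Proof.
move=> sX sY p Up; have := soliton sX sY Up.
rewrite soliton_lie// !soliton_xi//; lra.
Qed.

(** Substituting [soliton_ric] in [radial_ric]: the terms in [eta (x) eta]
    cancel, and a multiple of [h = g - eta (x) eta] is left. *)
Lemma soliton_radial Y Z : sv Y -> sv Z -> forall p, U p ->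
  (- c - 2 * (sigma p + lambda) + 2 * (d%:R - 1)) *
  (g p (Y p) (Z p) - eta p (Y p) * eta p (Z p)) = 0.
Proof.
move=> sY sZ p Up; have := radial_ric sY sZ Up.
rewrite (act_eq fc _ (h := fun q => - (sigma q + lambda) * g q (Y q) (Z q) +
    (sigma q - c - mu) * (eta q (Y q) * eta q (Z q))) _ Up); last first.
  by move=> q Uq; exact: soliton_ric.
have saff k f : sf f -> act xi (fun q => f q + k) p = act xi f p.
  move=> sF; rewrite (act_add fc)//; last by smooth.
  by rewrite (act_cst fc)// addr0.
have s1 : sf (fun q => - (sigma q + lambda)) by smooth.
have s2 : sf (fun q => sigma q - c - mu).
  by apply: (fc_add fc); [apply: (fc_add fc)|]; smooth.
rewrite (act_add fc)//; try by smooth.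
do 3 (rewrite (act_mul fc)//; try by smooth).
rewrite !act_eta// (mc_nab mc)//.
have -> : act xi (fun q => - (sigma q + lambda)) p = - c.
  rewrite (act_eq fc _ (h := fun q => 0 - (sigma q + lambda)) _ Up); last first.
    by move=> q _; rewrite sub0r.
  rewrite (act_sub fc)//; try by smooth.
  by rewrite (act_cst fc)// saff// soliton_xi// g_xi mulr1 sub0r.
have -> : act xi (fun q => sigma q - c - mu) p = c.
  rewrite saff; last by apply: (fc_add fc); smooth.
  by rewrite saff// soliton_xi// g_xi mulr1.
rewrite !soliton_ric//; try by smooth.
rewrite -(nab_torsion fc)// nab_xi// !gE g_xi.
rewrite !(mc_sym mc p (xi p)) /c; lra.
Qed.

(** Where [h] is not zero, [F] and its derivative along [xi] both vanish, which
    determines [sigma] and shows that [c = 0]. *)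
Lemma soliton_einstein Y Z : sv Y -> sv Z -> forall p, U p ->
  ric Y Z p = - (d%:R - 1) * g p (Y p) (Z p).
Proof.
move=> sY sZ p Up; rewrite soliton_ric//.
pose h q := g q (Y q) (Z q) - eta q (Y q) * eta q (Z q).
pose F q := - 2 * sigma q + (- c - 2 * lambda + 2 * (d%:R - 1)).
have Fh q : U q -> F q * h q = 0.
  move=> Uq; rewrite -(soliton_radial sY sZ Uq) /F /h; congr (_ * _); ring.
have [h0|h0] := eqVneq (h p) 0.
  by move: h0; rewrite /h /c => /subr0_eq ->; ring.
have sF : sf F by rewrite /F; smooth.
have sh : sf h by rewrite /h; smooth.
have F0 : F p = 0.
  by have /eqP := Fh p Up; rewrite mulf_eq0 (negPf h0) orbF => /eqP.
have c0 : c = 0.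
  have := act_mul fc xi sF sh Up.
  rewrite (act_eq fc _ (h := fun=> 0) _ Up) => //.
  rewrite (act_cst fc)// F0 mul0r add0r => /esym/eqP.
  rewrite mulf_eq0 (negPf h0) /= /F (act_add fc)//; try by smooth.
  rewrite (act_mul fc)//; try by smooth.
  rewrite !(act_cst fc)// soliton_xi// g_xi => /eqP; lra.
move: F0 c0; rewrite /F /c => F0 c0.
have -> : sigma p = d%:R - 1 - lambda by lra.
have -> : mu = d%:R - 1 - lambda by lra.
ring.
Qed.

End Soliton.
End Kenmotsu.

(** * The calculus over a chart domain *)

Section Instance.
Variables (R : realType) (d : nat) (M : smoothManifold R d).
Variables (g : forall p : M, tangent p -> tangent p -> R).
Variable nabla : vfield M -> vfield M -> vfield M.
Hypothesis metric_g : riemannian_metric g.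
Hypothesis lc_nabla : levi_civita g nabla.
Implicit Types (U : set M) (p q : M) (X Y Z : vfield M).

Definition field_act X (f : M -> R) q := tderiv (X q) f.

Definition chart_coframe p (i : 'I_d) q (v : 'rV[R]_d) : R :=
  tderiv (v : tangent q) (cmap (chart_at p)) 0 i.

(** [U] lies in the domain of a chart because vectors are separated by the
    coordinate functions, which have to be smooth on all of [U]. *)
Lemma chart_field_calculus p U : open U -> U `<=` cdom (chart_at p) ->
  field_calculus U (smooth_fun U) (smooth_vfield U) field_act (@bracket R d M) nabla.
Proof.
move=> oU Up; have cn := lc_connection lc_nabla; constructor.
- exact: smooth_fun_cst.
- by move=> f h; exact: smooth_funD.
- by move=> f h; exact: smooth_funM.
- by move=> X f; exact: smooth_tderiv.
- by move=> X Y; exact: smooth_vfieldD.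
- by move=> f X; exact: smooth_vfieldZ.
- by move=> X Y; exact: smooth_bracket.
- by move=> X Y; exact: (conn_smooth cn).
- by move=> X f h fh q Uq; exact: tderiv_eq oU Uq fh.
- by move=> X k q _; exact: tderiv_cst.
- move=> X f h sf sh q Uq; apply: tderivD; exact: smooth_differentiable_at Uq.
- move=> X f h sf sh q Uq; apply: tderivM; exact: smooth_differentiable_at Uq.
- move=> X Y k f sf q Uq; apply: tderiv_linear.
  exact: smooth_differentiable_at Uq.
- by move=> X Y f sX sY sf q Uq; exact: (tderiv_bracket oU sX sY sf Uq).
- move=> X Y q Uq XY; have cq := Up _ Uq; have ap := chart_at_atlas p.
  apply: (tangent_eq cq) => i; apply: XY.
  apply: smooth_fun_sub (smooth_fun_chart i ap); exact: Up.
- by move=> X X' Y Y' sX sX' sY sY' XX YY q Uq; exact: (conn_local cn oU).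
- by move=> f X X' Y sf sX sX' sY q Uq; exact: (conn_linear_l cn oU).
- by move=> X Y Y' sX sY sY' q Uq; exact: (conn_add_r cn oU).
- by move=> f X Y sf sX sY q Uq; exact: (conn_leibniz cn oU).
- by move=> X Y sX sY q Uq; exact: (lc_torsion_free lc_nabla oU).
Qed.

Lemma chart_metric_calculus p U : open U -> U `<=` cdom (chart_at p) ->
  metric_calculus U (smooth_fun U) (smooth_vfield U) field_act (@bracket R d M) nabla g.
Proof.
move=> oU Up; constructor.
- exact: chart_field_calculus Up.
- by move=> q u v; exact: (Defs.metric_sym metric_g).
- by move=> q u k v w; exact: (metric_linear metric_g).
- by move=> q v; exact: (metric_pos metric_g).
- by move=> X Y; exact: (metric_smooth metric_g).
- by move=> X Y Z sX sY sZ q Uq; exact: (lc_metric lc_nabla oU).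
Qed.

Lemma chart_frame_calculus p U : open U -> U `<=` cdom (chart_at p) ->
  frame_calculus U (smooth_fun U) (smooth_vfield U)
    (coord_vfield p) (chart_coframe p).
Proof.
move=> oU Up; have ap := chart_at_atlas p; constructor.
- by move=> i; apply: smooth_vfield_sub Up _; exact: smooth_coord_vfield.
- move=> i X sX; apply: smooth_fun_sub (sX _ ap i) => q Uq.
  by split => //; exact: Up.
- move=> i k u v q Uq; rewrite /chart_coframe tderiv_linear ?mxE//.
  by apply: cmap_differentiable_at => //; exact: Up.
- move=> i j q Uq; rewrite /chart_coframe coord_vfield_chart; last exact: Up.
  by rewrite /basis_vec mxE eqxx/= eq_sym.
- by move=> q v Uq; apply: coord_expansion; exact: Up.
Qed.

Lemma coframe_basis p q j (w : 'rV[R]_d) : cdom (chart_at p) q ->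
  chart_coframe p j q w = \sum_i w 0 i * chart_coframe p j q (basis_vec i).
Proof.
move=> cq; have dq : differentiable_at (cmap (chart_at p)) q.
  by apply: cmap_differentiable_at => //; exact: chart_at_atlas.
rewrite /chart_coframe {1}/tderiv derive_basis// summxE.
by apply: eq_bigr => i _; rewrite mxE.
Qed.

(** The coordinate frame of [chart_at q] is expanded in the one of [chart_at p]
    near [q]; the trace is unchanged since the curvature is tensorial. *)
Lemma ricci_trace p U Y Z q : open U -> U `<=` cdom (chart_at p) ->
  smooth_vfield U Y -> smooth_vfield U Z -> U q ->
  ricci nabla Y Z q =
  ric (@bracket R d M) nabla (coord_vfield p) (chart_coframe p) Y Z q.
Proof.
move=> oU Up sY sZ Uq; have cq := Up _ Uq; have qq := chart_at_dom q.
pose W := U `&` cdom (chart_at q).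
have oW : open W by apply: openI => //; exact: cdom_open.
have Wq : W q by [].
have WU : W `<=` U by move=> x [].
have Wp : W `<=` cdom (chart_at p) by move=> x [/Up].
have Wc : W `<=` cdom (chart_at q) by move=> x [].
have sY' := smooth_vfield_sub WU sY; have sZ' := smooth_vfield_sub WU sZ.
have mc := chart_metric_calculus oW Wp; have fr := chart_frame_calculus oW Wp.
have tA := tensorial_curv mc sY' sZ'.
have sE i : smooth_vfield W (coord_vfield q i).
  exact: smooth_vfield_sub Wc (smooth_coord_vfield q i).
have RE i : curvature nabla (coord_vfield q i) Y Z q =
    \sum_j chart_coframe p j q (basis_vec i) *:
      curv (@bracket R d M) nabla (coord_vfield p j) Y Z q.
  have := tensorial_sum mc tA (fun j => fr_component fr j (sE i))
    (fr_smooth fr) (sE i) (fun x Wx => fr_expansion fr _ Wx) Wq.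
  by rewrite coord_vfield_at.
rewrite /ricci (eq_bigr (fun i => \sum_j chart_coframe p j q (basis_vec i) *
    curv (@bracket R d M) nabla (coord_vfield p j) Y Z q 0 i)); last first.
  move=> i _; rewrite RE summxE; apply: eq_bigr => j _; exact: mxE.
rewrite exchange_big; apply: eq_bigr => j _.
rewrite (coframe_basis j _ cq); apply: eq_bigr => i _; exact: mulrC.
Qed.

Definition gram p := \matrix_(i < d, j < d) @g p (basis_vec i) (basis_vec j).

Lemma gramE p (u v : 'rV[R]_d) : @g p u v = (u *m gram p *m v^T) 0 0.
Proof.
have gZD (u' : 'rV[R]_d) k a b : @g p u' (k *: a + b) = k * @g p u' a + @g p u' b.
  exact: (metric_linear metric_g).
have gs (a b : 'rV[R]_d) : @g p a b = @g p b a by exact: (Defs.metric_sym metric_g).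
have g0 (a : 'rV[R]_d) : @g p a 0 = 0.
  by have := gZD a 1 0 0; rewrite scaler0 addr0 mul1r => /add_self_eq0.
have gsum (a : 'rV[R]_d) (F : 'I_d -> R) (G : 'I_d -> 'rV[R]_d) :
    @g p a (\sum_j F j *: G j) = \sum_j F j * @g p a (G j).
  elim: (index_enum _) => [|j s IH]; first by rewrite !big_nil.
  by rewrite !big_cons gZD IH.
rewrite [v in LHS]row_sum_delta gsum mxE; apply: eq_bigr => j _.
rewrite [RHS]mulrC !mxE; congr (_ * _).
rewrite gs [u in LHS]row_sum_delta gsum; apply: eq_bigr => i _.
by rewrite !mxE gs.
Qed.

Lemma gram_unit p : gram p \in unitmx.
Proof.
rewrite -row_free_unit -kermx_eq0; apply/rowV0P => v /sub_kermxP vG.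
apply/eqP/negPn/negP => v0.
have : 0 < @g p v v by exact: (metric_pos metric_g).
by rewrite gramE vG mul0mx mxE ltxx.
Qed.

Lemma scalar_curvature_einstein p (a : R) :
  (forall i j, ricci nabla (coord_vfield p i) (coord_vfield p j) p =
    a * @g p (coord_vfield p i p) (coord_vfield p j p)) ->
  scalar_curvature g nabla p = a * d%:R.
Proof.
move=> H; rewrite /scalar_curvature (_ : \matrix_(_, _) ricci _ _ _ _ = a *: gram p).
  by rewrite -scalemxAr mulVmx ?gram_unit// mxtraceZ mxtrace1.
by apply/matrixP => i j; rewrite !mxE H !coord_vfield_at.
Qed.

End Instance.

(** * Kenmotsu manifolds *)

Section KenmotsuStructure.
Variables (R : realType) (n : nat) (M : smoothManifold R (2 * n + 1)).
Variables (phi : forall p : M, tangent p -> tangent p) (xi : vfield M).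
Variables (eta : forall p : M, tangent p -> R).
Variables (g : forall p : M, tangent p -> tangent p -> R).
Variable nabla : vfield M -> vfield M -> vfield M.
Arguments phi : clear implicits.
Arguments eta : clear implicits.
Arguments g : clear implicits.
Hypothesis kM : kenmotsu phi xi eta g nabla.

Let acm : almost_contact_metric phi xi eta g := kenmotsu_acm kM.
Let ac : almost_contact phi xi eta := acm_contact acm.
Let mg : riemannian_metric g := acm_metric acm.

Lemma phiZD p k (u v : 'rV[R]_(2 * n + 1)) :
  phi p (k *: u + v) = k *: (phi p u : 'rV[R]__) + phi p v.
Proof. exact: (ac_phi_linear ac). Qed.

Lemma phi0 p : phi p 0 = 0 :> 'rV[R]__.
Proof.
by have := phiZD p 1 0 0; rewrite scaler0 addr0 scale1r => /add_self_eq0.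
Qed.

Lemma phiZ p k (u : 'rV[R]_(2 * n + 1)) :
  phi p (k *: u) = k *: (phi p u : 'rV[R]__).
Proof. by rewrite -[k *: u]addr0 phiZD phi0 addr0. Qed.

Lemma phi_sq p (v : 'rV[R]_(2 * n + 1)) :
  phi p (phi p v) = - v + eta p v *: (xi p : 'rV[R]__).
Proof. exact: (ac_phi_sq ac). Qed.

Lemma eta_xi p : eta p (xi p) = 1.
Proof. exact: (ac_eta_xi ac). Qed.

(** Since [phi (phi (phi xi))] is both [0] and [- phi xi + eta(phi xi) xi], the
    vector [phi xi] is [eta(phi xi) xi]; applying [phi] again gives
    [eta(phi xi) phi xi = 0]. *)
Lemma phi_xi p : phi p (xi p) = 0 :> 'rV[R]__.
Proof.
have sq0 : phi p (phi p (xi p)) = 0 by rewrite phi_sq eta_xi scale1r addNr.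
have E : phi p (xi p) = eta p (phi p (xi p)) *: (xi p : 'rV[R]__).
  by apply/eqP; rewrite -subr_eq0 -oppr_eq0 opprB addrC -phi_sq sq0 phi0.
have [k0|k0] := eqVneq (eta p (phi p (xi p))) 0.
  by rewrite E k0 scale0r.
have : eta p (phi p (xi p)) *: (phi p (xi p) : 'rV[R]__) = 0.
  by rewrite -phiZ -E.
by move/eqP; rewrite scaler_eq0 (negPf k0) => /eqP.
Qed.

Lemma etaZ p k (v : 'rV[R]_(2 * n + 1)) : eta p (k *: v) = k * eta p v.
Proof.
have etaZD a (u w : 'rV[R]__) : eta p (a *: u + w) = a * eta p u + eta p w.
  exact: (ac_eta_linear ac).
have eta0 : eta p 0 = 0.
  by have := etaZD 1 0 0; rewrite scaler0 addr0 mul1r => /add_self_eq0.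
by rewrite -[k *: v]addr0 etaZD eta0 addr0.
Qed.

Lemma eta_phi p (v : 'rV[R]_(2 * n + 1)) : eta p (phi p v) = 0.
Proof.
have E : phi p (phi p (phi p v)) = - (phi p v : 'rV[R]__).
  by rewrite (phi_sq p v) -scaleN1r phiZD phiZ phi_xi scaler0 addr0 scaleN1r.
have := phi_sq p (phi p v); rewrite E -{1}[- _]addr0 => /addrI/esym E'.
have : eta p (eta p (phi p v) *: (xi p : 'rV[R]__)) = eta p (0 *: (xi p : 'rV[R]__)).
  by rewrite E' scale0r.
by rewrite !etaZ eta_xi !mulr1.
Qed.

(** Compatibility of the metric with [phi], applied to [v] and [xi], where
    [phi xi = 0]. *)
Lemma g_xi p (v : 'rV[R]_(2 * n + 1)) : g p v (xi p) = eta p v.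
Proof.
have := acm_compatible acm v (xi p); rewrite phi_xi eta_xi mulr1.
have -> : g p (phi p v) 0 = 0.
  have : g p (phi p v) (1 *: 0 + 0) = 1 * g p (phi p v) 0 + g p (phi p v) 0.
    exact: (metric_linear mg).
  by rewrite scaler0 addr0 mul1r => /add_self_eq0.
by move/esym/eqP; rewrite subr_eq0 => /eqP.
Qed.

(** With [Y = xi] the Kenmotsu equation says that [phi] takes the same value on
    [nabla X xi] and on [X].  As [nabla X xi] is orthogonal to the unit field
    [xi], applying [phi] once more recovers it. *)
Lemma nabla_xi (U : set M) (X : vfield M) p0 : open U ->
  U `<=` cdom (chart_at p0) -> smooth_vfield U X -> forall p, U p ->
  nabla X xi p = X p - g p (X p) (xi p) *: xi p.
Proof.
move=> oU Up0 sX p Up.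
have mc := chart_metric_calculus mg (kenmotsu_lc kM) oU Up0.
have fc := mc_calculus mc.
have sxi : smooth_vfield U xi by apply: smooth_vfield_sub (ac_xi_smooth ac).
have n0 : nabla X (fun q => phi q (xi q)) p = 0.
  have -> : (fun q => phi q (xi q)) = (fun q => 0 *: (xi q : 'rV[R]__)).
    by apply/funext => q; rewrite phi_xi scale0r.
  rewrite (nab_scale fc (fc_cst fc 0) sX sxi Up) (act_cst fc _ _ Up).
  by rewrite !scale0r addr0.
have e0 : eta p (nabla X xi p) = 0.
  have := mc_nab mc sX sxi sxi Up.
  have -> : (fun q => g q (xi q) (xi q)) = fun=> 1.
    by apply/funext => q; rewrite g_xi eta_xi.
  rewrite (act_cst fc _ _ Up) (Defs.metric_sym mg (xi p)) !g_xi; lra.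
have := kenmotsu_eq kM oU sX sxi Up.
rewrite n0 sub0r g_xi eta_phi eta_xi scale0r scale1r sub0r => /oppr_inj E.
have := phi_sq p (nabla X xi p); rewrite E phi_sq e0 scale0r addr0 g_xi.
by move/(congr1 -%R); rewrite opprK opprD opprK => <-.
Qed.

End KenmotsuStructure.

Unset Implicit Arguments.

Theorem theorem3p3 (R : realType) (n : nat) (M : smoothManifold R (2 * n + 1))
    (phi : forall p : M, tangent p -> tangent p) (xi : vfield M)
    (eta : forall p : M, tangent p -> R)
    (g : forall p : M, tangent p -> tangent p -> R)
    (nabla : vfield M -> vfield M -> vfield M)
    (hK : kenmotsu phi xi eta g nabla)
    (V : vfield M) (hV : smooth_vfield setT V) (hV0 : exists p, V p <> 0)
    (hsol : exists lambda mu : R, eta_ricci_soliton eta g nabla V lambda mu)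
    (hcol : exists sigma : M -> R,
       smooth_fun setT sigma /\ forall p, V p = sigma p *: xi p) :
  einstein g nabla /\
  forall p : M, scalar_curvature g nabla p = - (2 * n * (2 * n + 1))%:R.
Proof.
have mg := acm_metric (kenmotsu_acm hK); have lc := kenmotsu_lc hK.
have [lambda [mu sol]] := hsol; have [sigma [ssigma VE]] := hcol.
have einst : forall (U : set M) (X Y : vfield M), open U ->
    smooth_vfield U X -> smooth_vfield U Y -> forall p, U p ->
    ricci nabla X Y p = - (2 * n)%:R * g p (X p) (Y p).
  move=> U X Y oU sX sY p Up; pose W := U `&` cdom (chart_at p).
  have oW : open W by apply: openI => //; exact: cdom_open.
  have Wp : W p by split => //; exact: chart_at_dom.
  have WU : W `<=` U by move=> q [].
  have Wc : W `<=` cdom (chart_at p) by move=> q [].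
  have sX' := smooth_vfield_sub WU sX; have sY' := smooth_vfield_sub WU sY.
  have mc := chart_metric_calculus mg lc oW Wc.
  have fr := chart_frame_calculus oW Wc.
  have sxi : smooth_vfield W xi.
    by apply: smooth_vfield_sub (ac_xi_smooth (acm_contact (kenmotsu_acm hK))).
  have sig : smooth_fun W sigma by apply: smooth_fun_sub ssigma.
  have gxx q : g q (xi q) (xi q) = 1 by rewrite (g_xi hK) (eta_xi hK).
  have nxi := fun Z (sZ : smooth_vfield W Z) => nabla_xi hK oW Wc sZ.
  have VE' : V = (fun q => sigma q *: (xi q : 'rV[R]__)) by apply/funext.
  have sol' : forall Y Z, smooth_vfield W Y -> smooth_vfield W Z ->
      forall q, W q -> 2^-1 * (field_act (fun q => sigma q *: (xi q : 'rV[R]__))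
         (fun q => g q (Y q) (Z q)) q
      - g q (bracket (fun q => sigma q *: (xi q : 'rV[R]__)) Y q) (Z q)
      - g q (Y q) (bracket (fun q => sigma q *: (xi q : 'rV[R]__)) Z q))
      + ric (@bracket R _ M) nabla (coord_vfield p) (chart_coframe p) Y Z q
      + lambda * g q (Y q) (Z q)
      + mu * (g q (Y q) (xi q) * g q (Z q) (xi q)) = 0.
    move=> A B sA sB q Wq; have := sol W A B oW sA sB q Wq.
    by rewrite (ricci_trace mg lc oW Wc sA sB Wq) VE' !(g_xi hK).
  rewrite (ricci_trace mg lc oW Wc sX' sY' Wp).
  rewrite (soliton_einstein mc fr sxi gxx nxi sig sol' sX' sY' Wp).
  by rewrite natrD addrK.
split; first by exists (- (2 * n)%:R).
move=> p; rewrite (scalar_curvature_einstein mg (a := - (2 * n)%:R)).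
  by rewrite mulNr -natrM.
move=> i j; apply: (einst (cdom (chart_at p))).
- exact: cdom_open.
- exact: smooth_coord_vfield.
- exact: smooth_coord_vfield.
- exact: chart_at_dom.
Qed.
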